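(* Let $(E,\langle\cdot,\cdot\rangle,\Theta)$ be a pre-Courant algebroid. Set $(\varepsilon_1,\varepsilon_2,\varepsilon_3)=(-1,-1,-1)$ in the hypersymplectic/hyperkähler case and $(\varepsilon_1,\varepsilon_2,\varepsilon_3)=(1,1,-1)$ in the para-hypersymplectic/para-hyperkähler case. The triplet $(\mathcal{S}_1,\mathcal{S}_2,\mathcal{S}_3)$ is a hypersymplectic (resp., para-hypersymplectic) structure on $(E,\Theta)$ if and only if $(\mathcal{T}_1,\mathcal{T}_2,\mathcal{T}_3,\mathcal{G})$ is a hyperkähler (resp., para-hyperkähler) structure on $(E,\Theta)$, with $\mathcal{S}_i=\varepsilon_i\varepsilon_{i-1}\mathcal{G}\mathcal{T}_i$, $i=1,2,3$ (indices in $\mathbb{Z}_3$). That is: (a) if $(\mathcal{S}_1,\mathcal{S}_2,\mathcal{S}_3)$ is a hypersymplectic (resp., para-hypersymplectic) structure on $(E,\Theta)$, then, with $\mathcal{T}_i:=\varepsilon_{i-1}\mathcal{S}_{i-1}\mathcal{S}_{i+1}$ and $\mathcal{G}:=\mathcal{S}_3\mathcal{S}_2\mathcal{S}_1$, the quadruple $(\mathcal{T}_1,\mathcal{T}_2,\mathcal{T}_3,\mathcal{G})$ is a hyperkähler (resp., para-hyperkähler) structure on $(E,\Theta)$ and $\mathcal{S}_i=\varepsilon_i\varepsilon_{i-1}\mathcal{G}\mathcal{T}_i$; (b) if $(\mathcal{T}_1,\mathcal{T}_2,\mathcal{T}_3,\mathcal{G})$ is a hyperkähler (resp., para-hyperkähler)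 structure on $(E,\Theta)$, then, with $\mathcal{S}_i:=\varepsilon_i\varepsilon_{i-1}\mathcal{G}\mathcal{T}_i$, the triplet $(\mathcal{S}_1,\mathcal{S}_2,\mathcal{S}_3)$ is a hypersymplectic (resp., para-hypersymplectic) structure on $(E,\Theta)$.
   Context: Let $E\to M$ be a vector bundle with a fibrewise non-degenerate symmetric bilinear form $\langle\cdot,\cdot\rangle$. A pre-Courant structure $\Theta$ on $(E,\langle\cdot,\cdot\rangle)$ is a pair $(\rho,[\cdot,\cdot])$, where $\rho:E\to TM$ is a morphism of vector bundles (the anchor) and $[\cdot,\cdot]:\Gamma(E)\times\Gamma(E)\to\Gamma(E)$ is an $\mathbb{R}$-bilinear (not necessarily skew-symmetric) bracket with $\rho(X)\cdot\langle Y,Z\rangle=\langle[X,Y],Z\rangle+\langle Y,[X,Z]\rangle$ and $\rho(X)\cdot\langle Y,Z\rangle=\langle X,[Y,Z]+[Z,Y]\rangle$ for all $X,Y,Z\in\Gamma(E)$. Then $(E,\langle\cdot,\cdot\rangle,\Theta)$, also written $(E,\Theta)$, is called a pre-Courant algebroid. Endomorphisms of $E$ are vector bundle morphisms over $\mathrm{id}_M$; juxtaposition is composition. The transpose $\mathcal{I}^*$ is defined by $\langle\mathcal{I}^*u,v\rangle=\langle u,\mathcal{I}v\rangle$; $\mathcal{I}$ is symmetric if $\mathcal{I}^*=\mathcal{I}$, skew-symmetric if $\mathcal{I}^*=-\mathcal{I}$, and orthogonal if $\mathcal{I}\mathcal{I}^*=\mathrm{id}_E$. The deformation of $\Theta=(\rho,[\cdot,\cdot])$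 by $\mathcal{I}$ is $\Theta_{\mathcal{I}}=(\rho\circ\mathcal{I},[\cdot,\cdot]_{\mathcal{I}})$ with $[X,Y]_{\mathcal{I}}=[\mathcal{I}X,Y]+[X,\mathcal{I}Y]-\mathcal{I}[X,Y]$; moreover $\Theta_{\mathcal{I},\mathcal{J}}=(\Theta_{\mathcal{I}})_{\mathcal{J}}$ and $c\,\Theta=(c\rho,c[\cdot,\cdot])$ for a constant $c$. The Nijenhuis torsion of $\mathcal{I}$ is $\mathsf{T}_{\Theta}\mathcal{I}(X,Y)=[\mathcal{I}X,\mathcal{I}Y]-\mathcal{I}([X,Y]_{\mathcal{I}})$. Hypersymplectic side. For $\boldsymbol{\varepsilon}=(\varepsilon_1,\varepsilon_2,\varepsilon_3)$ with $\varepsilon_i=\pm1$, an $\boldsymbol{\varepsilon}$-hypersymplectic structure on $(E,\Theta)$ is a triplet $(\mathcal{S}_1,\mathcal{S}_2,\mathcal{S}_3)$ of skew-symmetric endomorphisms of $E$ such that (i) $\mathcal{S}_i^2=\varepsilon_i\,\mathrm{id}_E$; (ii) $\mathcal{S}_i\mathcal{S}_j=\varepsilon_1\varepsilon_2\varepsilon_3\mathcal{S}_j\mathcal{S}_i$ for $i\neq j$; (iii) $\Theta_{\mathcal{S}_i,\mathcal{S}_i}=\varepsilon_i\Theta$. It is called hypersymplectic if $\boldsymbol{\varepsilon}=(-1,-1,-1)$, and para-hypersymplectic if $\varepsilon_1\varepsilon_2\varepsilon_3=-1$ with not all $\varepsilon_i$ equal to $-1$; in the latter case the indices are taken, after a cyclic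 permutation if necessary, so that $\boldsymbol{\varepsilon}=(1,1,-1)$. Hyperkähler side. A complex (resp. para-complex) structure on $(E,\Theta)$ is an endomorphism $\mathcal{J}$ of $E$ with $\mathcal{J}^2=-\mathrm{id}_E$ (resp. $\mathcal{J}^2=\mathrm{id}_E$) and $\mathsf{T}_{\Theta}\mathcal{J}=0$. A pseudo-metric is a symmetric and orthogonal bundle automorphism $G:E\to E$ (so $G^2=\mathrm{id}_E$). A hermitian (resp. para-hermitian) pair consists of a complex (resp. para-complex) structure $\mathcal{J}$ and a pseudo-metric $G$ such that $\langle G(\mathcal{J}X),\mathcal{J}Y\rangle=\langle G(X),Y\rangle$ (resp. $\langle G(\mathcal{J}X),\mathcal{J}Y\rangle=-\langle G(X),Y\rangle$) for all $X,Y\in\Gamma(E)$. A quadruple $(\mathcal{T}_1,\mathcal{T}_2,\mathcal{T}_3,\mathcal{G})$ of endomorphisms of $E$ is a hyperkähler (resp. para-hyperkähler) structure on $(E,\Theta)$ if: (1) $\mathcal{G}$ is a pseudo-metric; (2) $\mathcal{T}_1,\mathcal{T}_2$ are anti-commuting complex (resp. para-complex) structures and $\mathcal{T}_3=\mathcal{T}_1\mathcal{T}_2$; (3) $\mathcal{G}$ together with $\mathcal{T}_j$ forms a hermitian (resp. para-hermitian) pair for $j=1,2$; (4) $\mathsf{T}_{\Theta}(\mathcal{G}\mathcal{T}_j)=0$ for $j=1,2,3$.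
   Formalization: In (b), T_1 and T_2 are additionally assumed skew-symmetric, since (b) fails without this (zero anchor and bracket, G a reflection not commuting with T_j); correspondingly (a) also concludes that T_1 and T_2 are skew-symmetric. *)

(* Defs.v *)
From HB Require Import structures.
From mathcomp Require Import all_boot all_order all_algebra.
From mathcomp Require Import ring.
From mathcomp Require Import all_classical all_reals all_analysis.

Set Implicit Arguments.
Unset Strict Implicit.
Unset Printing Implicit Defensive.

Import Order.TTheory GRing.Theory Num.Theory.
Import numFieldNormedType.Exports.

Local Open Scope classical_set_scope.
Local Open Scope ring_scope.

Section SmoothOn.
Variables (R : realType) (V : normedModType R).
Implicit Types (U : set V) (f g : V -> R).

Definition iter_derive (vs : seq V) (f : V -> R) : V -> R :=
  foldl (fun g v => 'D_v g) f vs.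

(* [U] is meant to be open: all iterated directional derivatives of [f] are
   differentiable at every point of [U]. *)
Definition smooth_on U f :=
  forall vs x, U x -> differentiable (iter_derive vs f) x.

Lemma smooth_on_derive U f v : smooth_on U f -> smooth_on U ('D_v f).
Proof. by move=> sf vs; exact: (sf (v :: vs)). Qed.

Lemma smooth_on_derivable U f v x : smooth_on U f -> U x -> derivable f x v.
Proof. by move=> sf Ux; apply: diff_derivable; exact: (sf [::]). Qed.

Lemma differentiable_near0 f x : {near x, f =1 cst 0} -> differentiable f x.
Proof.
move=> f0.
have e : f \o shift x = cst (f x) + (\0 : V -> R) +o_ 0 id.
  apply/eqaddoP => _/posnumP[e]; have := f0; rewrite (near_shift 0) /= => h.
  have fx0 := nbhs_singleton f0.
  near=> y; rewrite !fctE /= fx0 !add0r !subr0.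
  have -> : f (y + x) = 0.
    have : ((f \o shift (x - 0)) y = 0) by near: y.
    by rewrite /= subr0.
  by rewrite normr0 mulr_ge0.
apply/diff_locallyP; rewrite (diff_unique _ e); first by split=> //; exact: cst_continuous.
exact: cst_continuous.
Unshelve. all: by end_near. Qed.

Lemma differentiable_near_eq f g x :
  {near x, f =1 g} -> differentiable f x -> differentiable g x.
Proof.
move=> fg df; rewrite -(subrK f g) addrC; apply: differentiableD => //.
apply: differentiable_near0; near=> y.
by rewrite !fctE (near fg y) // subrr.
Unshelve. all: by end_near. Qed.

Lemma open_near_eq U f g x : open U -> U x ->
  (forall y, U y -> f y = g y) -> {near x, f =1 g}.
Proof.
by move=> oU Ux fg; near=> y; apply: fg; near: y; exact: open_nbhs_nbhs.
Unshelve. all: by end_near. Qed.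

Lemma smooth_on_ext U f g : open U -> (forall x, U x -> f x = g x) ->
  smooth_on U f -> smooth_on U g.
Proof.
move=> oU fg sf vs; elim: vs f g fg sf => [|v vs IH] f g fg sf x Ux.
  by apply: (differentiable_near_eq (open_near_eq oU Ux fg)); exact: (sf [::]).
apply: (IH ('D_v f)) => // [y Uy|]; last exact: smooth_on_derive.
by apply: near_eq_derive; exact: (open_near_eq oU Uy fg).
Qed.

Lemma smooth_on_cst U (a : R) : smooth_on U (cst a).
Proof.
move=> vs x _; elim: vs a => [|v vs IH] a; first exact: differentiable_cst.
by rewrite /= (_ : 'D_v (cst a) = cst 0)//; apply/funext => y; rewrite derive_cst.
Qed.

Lemma iter_derive_ext U vs f g : open U -> (forall x, U x -> f x = g x) ->
  forall x, U x -> iter_derive vs f x = iter_derive vs g x.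
Proof.
move=> oU; elim: vs f g => //= v vs IH f g fg x Ux; apply: IH => // y Uy.
by apply: near_eq_derive; exact: (open_near_eq oU Uy fg).
Qed.

Lemma differentiable_iter_derive_ext U vs f g x : open U -> U x ->
  (forall x, U x -> f x = g x) ->
  differentiable (iter_derive vs f) x -> differentiable (iter_derive vs g) x.
Proof.
move=> oU Ux fg; apply: differentiable_near_eq; apply: (open_near_eq oU Ux).
exact: iter_derive_ext.
Qed.

Lemma smooth_onD U f g : open U ->
  smooth_on U f -> smooth_on U g -> smooth_on U (f + g).
Proof.
move=> oU sf sg vs; elim: vs f g sf sg => [|v vs IH] f g sf sg x Ux /=.
  by apply: differentiableD; [exact: (sf [::])|exact: (sg [::])].
apply: (differentiable_iter_derive_ext oU Ux _
  (IH _ _ (smooth_on_derive v sf) (smooth_on_derive v sg) x Ux)) => y Uy.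
by rewrite deriveD //; [exact: smooth_on_derivable sf Uy|exact: smooth_on_derivable sg Uy].
Qed.

Lemma smooth_onM U f g : open U ->
  smooth_on U f -> smooth_on U g -> smooth_on U (f * g).
Proof.
move=> oU sf sg.
pose P n f := forall vs, (size vs <= n)%N ->
  forall x, U x -> differentiable (iter_derive vs f) x.
have PD n : forall h k, P n h -> P n k -> P n (h + k).
  elim: n => [|n IH] h k Ph Pk [|v vs] //= sz x Ux.
  - by apply: differentiableD; [exact: (Ph [::])|exact: (Pk [::])].
  - by apply: differentiableD; [exact: (Ph [::])|exact: (Pk [::])].
  have Ph' : P n ('D_v h) by move=> ws szw; exact: (Ph (v :: ws)).
  have Pk' : P n ('D_v k) by move=> ws szw; exact: (Pk (v :: ws)).
  apply: (differentiable_iter_derive_ext oU Ux _ (IH _ _ Ph' Pk' vs sz x Ux)).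
  move=> y Uy; rewrite deriveD //; apply: diff_derivable.
  - exact: (Ph [::]).
  - exact: (Pk [::]).
suff PM n : P n (f * g) by move=> vs; exact: (PM (size vs)).
elim: n f g sf sg => [|n IH] f g sf sg [|v vs] //= sz x Ux.
- by apply: differentiableM; [exact: (sf [::])|exact: (sg [::])].
- by apply: differentiableM; [exact: (sf [::])|exact: (sg [::])].
have P1 := IH _ _ sf (smooth_on_derive v sg).
have P2 := IH _ _ sg (smooth_on_derive v sf).
apply: (differentiable_iter_derive_ext oU Ux _ (PD _ _ _ P1 P2 vs sz x Ux)).
move=> y Uy; rewrite deriveM //; [exact: smooth_on_derivable sf Uy|exact: smooth_on_derivable sg Uy].
Qed.

End SmoothOn.

Record chart (R : realType) (n : nat) (M : topologicalType) := Chart {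
  chart_dom : set M;
  chart_cod : set 'rV[R]_n;
  chart_map : M -> 'rV[R]_n;
  chart_inv : 'rV[R]_n -> M;
  chart_dom_open : open chart_dom;
  chart_cod_open : open chart_cod;
  chart_mapP : forall p, chart_dom p -> chart_cod (chart_map p);
  chart_invP : forall x, chart_cod x -> chart_dom (chart_inv x);
  chart_mapK : forall p, chart_dom p -> chart_inv (chart_map p) = p;
  chart_invK : forall x, chart_cod x -> chart_map (chart_inv x) = x;
  chart_map_continuous : forall p, chart_dom p -> {for p, continuous chart_map};
  chart_inv_continuous : forall x, chart_cod x -> {for x, continuous chart_inv} }.

Record manifold (R : realType) (n : nat) := Manifold {
  carrier :> topologicalType;
  manifold_hausdorff : hausdorff_space carrier;
  manifold_second_countable : @second_countable carrier;
  atlas : set (chart R n carrier);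
  atlas_cover : forall p : carrier, exists2 c, atlas c & chart_dom c p;
  atlas_compatible : forall c d, atlas c -> atlas d -> forall i,
    smooth_on (chart_cod c `&` chart_inv c @^-1` chart_dom d)
      (fun x => chart_map d (chart_inv c x) 0 i) }.

Section SmoothFunctions.
Variables (R : realType) (n : nat) (M : manifold R n).
Implicit Types (U : set M) (f g : M -> R).

(* [U] is meant to be open. *)
Definition msmooth U f := forall c, atlas c ->
  smooth_on (chart_cod c `&` chart_inv c @^-1` U) (f \o chart_inv c).

Lemma chart_pre_open (c : chart R n M) U :
  open U -> open (chart_cod c `&` chart_inv c @^-1` U).
Proof.
move=> oU; rewrite openE => x [cx Ux]; apply: filterI.
- by apply: open_nbhs_nbhs; split=> //; exact: chart_cod_open.
- apply: (chart_inv_continuous cx); exact: open_nbhs_nbhs.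
Qed.

Lemma msmooth_ext U f g : open U -> (forall p, U p -> f p = g p) ->
  msmooth U f -> msmooth U g.
Proof.
move=> oU fg sf c ac; apply: smooth_on_ext (sf c ac); first exact: chart_pre_open.
by move=> x [_ Ux]; exact: fg.
Qed.

Lemma msmooth_cst U (a : R) : msmooth U (cst a).
Proof. by move=> c _; exact: smooth_on_cst. Qed.

Lemma msmoothD U f g : open U ->
  msmooth U f -> msmooth U g -> msmooth U (f + g).
Proof.
by move=> oU sf sg c ac; apply: smooth_onD;
  [exact: chart_pre_open|exact: sf|exact: sg].
Qed.

Lemma msmoothM U f g : open U ->
  msmooth U f -> msmooth U g -> msmooth U (f * g).
Proof.
by move=> oU sf sg c ac; apply: smooth_onM;
  [exact: chart_pre_open|exact: sf|exact: sg].
Qed.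

Lemma msmooth_sum U I (s : seq I) (F : I -> M -> R) : open U ->
  (forall i, msmooth U (F i)) -> msmooth U (fun p => \sum_(i <- s) F i p).
Proof.
move=> oU sF; rewrite -fct_sumE; elim/big_ind : _ => //.
- exact: msmooth_cst.
- by move=> *; exact: msmoothD.
Qed.

Lemma msmoothS U U' f : U' `<=` U -> msmooth U f -> msmooth U' f.
Proof. by move=> sU sf c ac vs x [cx U'x]; apply: sf => //; split=> //; exact: sU. Qed.

Lemma msmooth_cover f : (forall p, exists2 U, U p & msmooth U f) ->
  msmooth setT f.
Proof.
by move=> sf c ac vs x [cx _]; have [U Ux sfU] := sf (chart_inv c x); exact: sfU.
Qed.

Definition smooth_pred : {pred M -> R} := fun f => `[< msmooth setT f >].

Fact smooth_subring : GRing.subring_closed smooth_pred.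
Proof.
have s1 : 1 \in smooth_pred by apply/asboolP; exact: msmooth_cst.
have sM : GRing.mulr_2closed smooth_pred.
  move=> f g /asboolP sf /asboolP sg; apply/asboolP; apply: msmoothM => //.
  exact: openT.
split=> // f g sf /asboolP sg; apply/asboolP; apply: msmoothD => //.
- exact: openT.
- exact/asboolP.
- rewrite -mulN1r; apply: msmoothM => //; first exact: openT.
  exact: (@msmooth_cst setT (-1)).
Qed.
Fact smooth_scaler : GRing.scaler_closed smooth_pred.
Proof.
move=> a f /asboolP sf; apply/asboolP.
by apply: (@msmoothM setT (cst a) f) => //; [exact: openT|exact: msmooth_cst].
Qed.
HB.instance Definition _ :=
  GRing.isSubringClosed.Build _ smooth_pred smooth_subring.
HB.instance Definition _ :=
  GRing.isScaleClosed.Build R _ smooth_pred smooth_scaler.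

(* C^oo(M) *)
Definition Cinf := {f : M -> R | f \in smooth_pred}.
HB.instance Definition _ := SubChoice.on Cinf.
HB.instance Definition _ := GRing.SubChoice_isSubComPzRing.Build _ _ Cinf (GRing.subringClosedP _).
HB.instance Definition _ := [SubZmodule_isSubLmodule of Cinf by <:].

Definition Cinf_eval (f : Cinf) : M -> R := val f.
Coercion Cinf_eval : Cinf >-> Funclass.

Lemma CinfP (f : Cinf) U : msmooth U f.
Proof. by apply: (@msmoothS setT) => //; exact: (asboolW (valP f)). Qed.

Definition mkCinf f (sf : msmooth setT f) : Cinf :=
  Sub f (introT (asboolP _) sf).

(* T_p M is the space of derivations of C^oo(M) at p. *)
Definition derivation_at (p : M) (D : Cinf -> R^o) :=
  linear D /\ forall f g : Cinf, D (f * g) = D f * g p + f p * D g.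

Definition derivation_pred (p : M) : {pred Cinf -> R^o} :=
  fun D => `[< derivation_at p D >].

Fact derivation_submod p : GRing.submod_closed (derivation_pred p).
Proof.
split.
- have e0 h : (0 : Cinf -> R^o) h = 0 by [].
  apply/asboolP; split=> [a f g|f g]; rewrite !e0.
    by rewrite scaler0 addr0.
  by rewrite mul0r mulr0 addr0.
- move=> a D D' /asboolP[lD mD] /asboolP[lD' mD']; apply/asboolP.
  have eD h : (a *: D + D') h = a * D h + D' h by [].
  split=> [b f g|f g]; rewrite !eD.
    by rewrite lD lD' /GRing.scale /=; ring.
  by rewrite mD mD'; ring.
Qed.
HB.instance Definition _ p :=
  GRing.isSubmodClosed.Build R _ (derivation_pred p) (derivation_submod p).

Definition tangent (p : M) := {D : Cinf -> R^o | D \in derivation_pred p}.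
HB.instance Definition _ p := SubChoice.on (tangent p).
HB.instance Definition _ p := [SubChoice_isSubZmodule of tangent p by <:].
HB.instance Definition _ p := [SubZmodule_isSubLmodule of tangent p by <:].

Definition tangent_eval p (D : tangent p) : Cinf -> R := val D.
Coercion tangent_eval : tangent >-> Funclass.

End SmoothFunctions.
Arguments Cinf {R n} M.

Section Fiberwise.
Variables (R : pzRingType) (M : Type) (F : M -> lmodType R).

Definition fiberwise := forall p, F p.
HB.instance Definition _ := gen_eqMixin fiberwise.
HB.instance Definition _ := gen_choiceMixin fiberwise.

Let add (s t : fiberwise) : fiberwise := fun p => s p + t p.
Let opp (s : fiberwise) : fiberwise := fun p => - s p.
Let zero : fiberwise := fun p => 0.
Let scale a (s : fiberwise) : fiberwise := fun p => a *: s p.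

Let ext (s t : fiberwise) : (forall p, s p = t p) -> s = t.
Proof. exact: functional_extensionality_dep. Qed.

Fact fw_addrA : associative add.
Proof. by move=> s t u; apply: ext => p; exact: addrA. Qed.
Fact fw_addrC : commutative add.
Proof. by move=> s t; apply: ext => p; exact: addrC. Qed.
Fact fw_add0r : left_id zero add.
Proof. by move=> s; apply: ext => p; exact: add0r. Qed.
Fact fw_addNr : left_inverse zero opp add.
Proof. by move=> s; apply: ext => p; exact: addNr. Qed.
HB.instance Definition _ :=
  GRing.isZmodule.Build fiberwise fw_addrA fw_addrC fw_add0r fw_addNr.

Fact fw_scalerA a b s : scale a (scale b s) = scale (a * b) s.
Proof. by apply: ext => p; exact: scalerA. Qed.
Fact fw_scale1r : left_id 1 scale.
Proof. by move=> s; apply: ext => p; exact: scale1r. Qed.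
Fact fw_scalerDr : right_distributive scale +%R.
Proof. by move=> a s t; apply: ext => p; exact: scalerDr. Qed.
Fact fw_scalerDl s : {morph scale^~ s : a b / a + b}.
Proof. by move=> a b; apply: ext => p; exact: scalerDl. Qed.
HB.instance Definition _ := GRing.Zmodule_isLmodule.Build R fiberwise
  fw_scalerA fw_scale1r fw_scalerDr fw_scalerDl.

Lemma fiberwiseP (s t : fiberwise) : (forall p, s p = t p) -> s = t.
Proof. exact: ext. Qed.

End Fiberwise.

Record frame (R : realType) (n : nat) (M : manifold R n) (r : nat)
    (E : M -> vectType R) := Frame {
  frame_dom : set M;
  frame_vec : forall p, r.-tuple (E p);
  frame_dom_open : open frame_dom;
  frame_basis : forall p, frame_dom p -> basis_of fullv (frame_vec p) }.

Definition frame_coord R n (M : manifold R n) r (E : M -> vectType R)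
    (e : frame r E) (i : 'I_r) (p : M) (v : E p) : R :=
  coord (frame_vec e p) i v.

(* A vector bundle of rank [r] is given by its fibres and an atlas of local
   frames with smooth transition functions; the frames determine the smooth
   structure of the total space. *)
Record vbundle (R : realType) (n : nat) (M : manifold R n) (r : nat) := VBundle {
  fiber :> M -> vectType R;
  frames : set (frame r fiber);
  frames_cover : forall p : M, exists2 e, frames e & frame_dom e p;
  frames_compatible : forall e e', frames e -> frames e' -> forall i j,
    msmooth (frame_dom e `&` frame_dom e')
      (fun p => frame_coord e i (tnth (frame_vec e' p) j)) }.

Section Bundle.
Variables (R : realType) (n : nat) (M : manifold R n) (r : nat).
Variable E : vbundle M r.

Lemma frame_decomp (e : frame r E) p (v : E p) : frame_dom e p ->
  v = \sum_(j < r) frame_coord e j v *: tnth (frame_vec e p) j.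
Proof.
move=> /frame_basis /coord_basis h; rewrite {1}(h v (memvf v)).
by apply: eq_bigr => j _; rewrite (tnth_nth 0).
Qed.

Definition smooth_section_pred : {pred fiberwise (fun p => E p)} := fun s =>
  `[< forall e, frames e -> forall i,
        msmooth (frame_dom e) (fun p => frame_coord e i (s p)) >].

Fact smooth_section_submod : GRing.submod_closed smooth_section_pred.
Proof.
split.
- apply/asboolP => e _ i; apply: (msmooth_ext (@frame_dom_open _ _ _ _ _ e) _
    (@msmooth_cst _ _ _ (frame_dom e) 0)) => p _.
  by rewrite /frame_coord linear0.
- move=> a s t /asboolP ss /asboolP st; apply/asboolP => e fe i.
  have oe := @frame_dom_open _ _ _ _ _ e.
  apply: (msmooth_ext oe _ (msmoothD oe
    (msmoothM oe (@msmooth_cst _ _ _ _ a) (ss e fe i)) (st e fe i))) => p _.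
  by rewrite /frame_coord linearP.
Qed.
HB.instance Definition _ := GRing.isSubmodClosed.Build R _
  smooth_section_pred smooth_section_submod.

(* Gamma(E) *)
Definition Sec := {s : fiberwise (fun p => E p) | s \in smooth_section_pred}.
HB.instance Definition _ := SubChoice.on Sec.
HB.instance Definition _ := [SubChoice_isSubZmodule of Sec by <:].
HB.instance Definition _ := [SubZmodule_isSubLmodule of Sec by <:].

Definition Sec_eval (X : Sec) : forall p, E p := val X.
Coercion Sec_eval : Sec >-> Funclass.

Lemma SecP (X : Sec) e i : frames e ->
  msmooth (frame_dom e) (fun p => frame_coord e i (X p)).
Proof. by move=> fe; exact: (asboolW (valP X)). Qed.

Definition mkSec (s : fiberwise (fun p => E p)) (ss : forall e, frames e -> forall i,
    msmooth (frame_dom e) (fun p => frame_coord e i (s p))) : Sec :=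
  Sub s (introT (asboolP _) ss).

(* Vector bundle morphisms E -> E over the identity: fibrewise linear, with
   smooth matrix entries in every local frame. *)
Definition smooth_endo_pred : {pred fiberwise (fun p => 'End(E p))} := fun I =>
  `[< forall e, frames e -> forall i j, msmooth (frame_dom e)
        (fun p => frame_coord e i (I p (tnth (frame_vec e p) j))) >].

Fact smooth_endo_submod : GRing.submod_closed smooth_endo_pred.
Proof.
split.
- apply/asboolP => e _ i j; apply: (msmooth_ext (@frame_dom_open _ _ _ _ _ e) _
    (@msmooth_cst _ _ _ (frame_dom e) 0)) => p _.
  by rewrite /frame_coord lfunE linear0.
- move=> a s t /asboolP ss /asboolP st; apply/asboolP => e fe i j.
  have oe := @frame_dom_open _ _ _ _ _ e.
  apply: (msmooth_ext oe _ (msmoothD oe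
    (msmoothM oe (@msmooth_cst _ _ _ _ a) (ss e fe i j)) (st e fe i j))) => p _.
  rewrite /frame_coord.
  have -> : (a *: s + t) p = a *: s p + t p by [].
  by rewrite add_lfunE scale_lfunE linearP.
Qed.
HB.instance Definition _ := GRing.isSubmodClosed.Build R _
  smooth_endo_pred smooth_endo_submod.

Definition Endo :=
  {I : fiberwise (fun p => 'End(E p)) | I \in smooth_endo_pred}.
HB.instance Definition _ := SubChoice.on Endo.
HB.instance Definition _ := [SubChoice_isSubZmodule of Endo by <:].
HB.instance Definition _ := [SubZmodule_isSubLmodule of Endo by <:].

Definition Endo_eval (I : Endo) : forall p, 'End(E p) := val I.
Coercion Endo_eval : Endo >-> Funclass.

Lemma EndoP (I : Endo) e i j : frames e -> msmooth (frame_dom e)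
  (fun p => frame_coord e i (I p (tnth (frame_vec e p) j))).
Proof. by move=> fe; exact: (asboolW (valP I)). Qed.

Definition mkEndo (I : fiberwise (fun p => 'End(E p)))
    (sI : forall e, frames e -> forall i j, msmooth (frame_dom e)
      (fun p => frame_coord e i (I p (tnth (frame_vec e p) j)))) : Endo :=
  Sub I (introT (asboolP _) sI).

Lemma smooth_linear_form (e : frame r E) (L : forall p, E p -> R)
    (s : forall p, E p) :
  (forall p, scalar (L p)) ->
  (forall i, msmooth (frame_dom e) (fun p => L p (tnth (frame_vec e p) i))) ->
  (forall i, msmooth (frame_dom e) (fun p => frame_coord e i (s p))) ->
  msmooth (frame_dom e) (fun p => L p (s p)).
Proof.
move=> lL sL ss; have oe := @frame_dom_open _ _ _ _ _ e.
apply: (msmooth_ext oe _ (msmooth_sum (index_enum 'I_r) oe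
  (fun j => msmoothM oe (ss j) (sL j)))) => p ep.
have L0 : L p 0 = 0.
  by have := lL p 1 0 0; rewrite scaler0 addr0 mul1r => /eqP;
     rewrite -subr_eq subrr eq_sym => /eqP.
have LD u v : L p (u + v) = L p u + L p v.
  by have := lL p 1 u v; rewrite scale1r mul1r.
rewrite [in RHS](frame_decomp (s p) ep) (big_morph (L p) LD L0).
by apply: eq_bigr => j _; have := lL p (frame_coord e j (s p))
  (tnth (frame_vec e p) j) 0; rewrite !addr0 L0 addr0.
Qed.

Fact Endo_id_smooth e : frames e -> forall i j, msmooth (frame_dom e)
  (fun p => frame_coord e i ((\1%VF : 'End(E p)) (tnth (frame_vec e p) j))).
Proof.
move=> fe i j; apply: (msmooth_ext (@frame_dom_open _ _ _ _ _ e) _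
  (@msmooth_cst _ _ _ (frame_dom e) (j == i)%:R)) => p ep.
rewrite /frame_coord id_lfunE (tnth_nth 0) coord_free //.
exact: basis_free (frame_basis ep).
Qed.

Definition Endo_id : Endo := mkEndo Endo_id_smooth.

Fact Endo_comp_smooth (I J : Endo) e : frames e -> forall i j,
  msmooth (frame_dom e) (fun p =>
    frame_coord e i ((I p \o J p)%VF (tnth (frame_vec e p) j))).
Proof.
move=> fe i j; have oe := @frame_dom_open _ _ _ _ _ e.
apply: (msmooth_ext oe _ (@smooth_linear_form e
  (fun p v => frame_coord e i (I p v)) (fun p => J p (tnth (frame_vec e p) j))
  _ _ _)) => [p _|p a u v|k|k].
- by rewrite comp_lfunE.
- by rewrite /frame_coord !linearP.
- exact: EndoP.
- exact: EndoP.
Qed.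

Definition Endo_comp (I J : Endo) : Endo :=
  mkEndo (@Endo_comp_smooth I J).

Fact Endo_app_smooth (I : Endo) (X : Sec) e : frames e -> forall i,
  msmooth (frame_dom e) (fun p => frame_coord e i (I p (X p))).
Proof.
move=> fe i; apply: (@smooth_linear_form e (fun p v => frame_coord e i (I p v))).
- by move=> p a u v; rewrite /frame_coord !linearP.
- by move=> k; exact: EndoP.
- by move=> k; exact: SecP.
Qed.

Definition Endo_app (I : Endo) (X : Sec) : Sec :=
  @mkSec (fun p => I p (X p)) (@Endo_app_smooth I X).

Record metric := Metric {
  metric_form : forall p, E p -> E p -> R;
  metric_linear : forall p (u : E p), scalar (metric_form u);
  metric_sym : forall p (u v : E p), metric_form u v = metric_form v u;
  metric_nondegenerate : forall p (u : E p), (forall v, metric_form u v = 0) -> u = 0;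
  metric_smooth : forall e, frames e -> forall i j, msmooth (frame_dom e)
    (fun p => metric_form (tnth (frame_vec e p) i) (tnth (frame_vec e p) j)) }.

Fact pairing_smooth (g : metric) (X Y : Sec) :
  msmooth setT (fun p => metric_form g (X p) (Y p)).
Proof.
apply: msmooth_cover => p; have [e fe ep] := frames_cover E p.
exists (frame_dom e) => //.
apply: (@smooth_linear_form e (fun p v => metric_form g (X p) v)) => [q a u v|i|i].
- exact: metric_linear.
- apply: (@smooth_linear_form e
    (fun p v => metric_form g v (tnth (frame_vec e p) i))) => [q a u v|j|j].
  + by rewrite !(metric_sym g _ (tnth _ _)) metric_linear.
  + exact: metric_smooth.
  + exact: SecP.
- exact: SecP.
Qed.

Definition pairing (g : metric) (X Y : Sec) : Cinf M :=
  mkCinf (pairing_smooth g X Y).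

(* Vector bundle morphisms E -> TM over the identity. Smoothness: the local
   vector field [rho e_i] maps smooth functions to smooth functions, for every
   member [e_i] of a local frame of E. *)
Record anchor := Anchor {
  anchor_fun : forall p, E p -> tangent p;
  anchor_linear : forall p, linear (@anchor_fun p);
  anchor_smooth : forall e, frames e -> forall i (f : Cinf M),
    msmooth (frame_dom e)
      (fun p => anchor_fun (tnth (frame_vec e p) i) f) }.

Lemma anchor_scalar (rho : anchor) p (f : Cinf M) :
  scalar (fun u : E p => anchor_fun rho u f : R).
Proof. by move=> a u v; rewrite (anchor_linear rho a u v). Qed.

Fact anchor_app_smooth (rho : anchor) (X : Sec) (f : Cinf M) :
  msmooth setT (fun p => anchor_fun rho (X p) f).
Proof.
apply: msmooth_cover => p; have [e fe ep] := frames_cover E p.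
exists (frame_dom e) => //.
apply: (@smooth_linear_form e (fun p v => anchor_fun rho v f)).
- by move=> q; exact: anchor_scalar.
- by move=> i; exact: anchor_smooth.
- by move=> i; exact: SecP.
Qed.

(* rho(X).f *)
Definition anchor_app (rho : anchor) (X : Sec) (f : Cinf M) : Cinf M :=
  mkCinf (anchor_app_smooth rho X f).

Fact anchor_comp_linear (rho : anchor) (I : Endo) p :
  linear (fun u : E p => anchor_fun rho (I p u)).
Proof. by move=> a u v; rewrite linearP anchor_linear. Qed.

Fact anchor_comp_smooth (rho : anchor) (I : Endo) e : frames e ->
  forall i (f : Cinf M), msmooth (frame_dom e)
    (fun p => anchor_fun rho (I p (tnth (frame_vec e p) i)) f).
Proof.
move=> fe i f; apply: (@smooth_linear_form e (fun p v => anchor_fun rho v f)).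
- by move=> q; exact: anchor_scalar.
- by move=> j; exact: anchor_smooth.
- by move=> j; exact: EndoP.
Qed.

Definition anchor_comp (rho : anchor) (I : Endo) : anchor :=
  Anchor (anchor_comp_linear rho I) (@anchor_comp_smooth rho I).

Fact anchor_scale_linear (c : R) (rho : anchor) p :
  linear (fun u : E p => c *: anchor_fun rho u).
Proof. by move=> a u v; rewrite anchor_linear scalerDr !scalerA mulrC. Qed.

Fact anchor_scale_smooth (c : R) (rho : anchor) e : frames e ->
  forall i (f : Cinf M), msmooth (frame_dom e)
    (fun p => tangent_eval (c *: anchor_fun rho (tnth (frame_vec e p) i)) f).
Proof.
move=> fe i f; have oe := @frame_dom_open _ _ _ _ _ e.
exact: (msmoothM oe (@msmooth_cst _ _ _ _ c) (anchor_smooth rho fe i f)).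
Qed.

Definition anchor_scale (c : R) (rho : anchor) : anchor :=
  Anchor (@anchor_scale_linear c rho) (@anchor_scale_smooth c rho).

(* Pairs (rho, [.,.]) without the compatibility axioms with the metric, so that
   deformations, which need not satisfy them, make sense. *)
Record prestructure := PreStructure {
  anc : anchor;
  bracket : Sec -> Sec -> Sec;
  bracket_linear_l : forall Y, linear (bracket^~ Y);
  bracket_linear_r : forall X, linear (bracket X) }.

Definition pre_courant (g : metric) (Theta : prestructure) :=
  (forall X Y Z : Sec,
     anchor_app (anc Theta) X (pairing g Y Z)
     = pairing g (bracket Theta X Y) Z + pairing g Y (bracket Theta X Z)) /\
  (forall X Y Z : Sec,
     anchor_app (anc Theta) X (pairing g Y Z)
     = pairing g X (bracket Theta Y Z + bracket Theta Z Y)).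

End Bundle.

Notation "I \oE J" := (Endo_comp I J) (at level 50, left associativity).

Section Deformation.
Variables (R : realType) (n : nat) (M : manifold R n) (r : nat).
Variable E : vbundle M r.
Implicit Types (Theta : prestructure E) (I J : Endo E) (X Y : Sec E).

Fact Endo_app_linear I : linear (Endo_app I).
Proof. by move=> a X Y; apply/val_inj/fiberwiseP => p; exact: linearP. Qed.

Definition deform_bracket Theta I X Y : Sec E :=
  bracket Theta (Endo_app I X) Y + bracket Theta X (Endo_app I Y)
  - Endo_app I (bracket Theta X Y).

Fact linear_combination3 (V : lmodType R) a (x x' y y' z z' : V) :
  a *: x + x' + (a *: y + y') - (a *: z + z')
  = a *: (x + y - z) + (x' + y' - z').
Proof. by rewrite scalerBr scalerDr opprD (addrACA (a *: x)) (addrACA (a *: x + _)). Qed.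

Fact deform_bracket_linear_l Theta I Y :
  linear ((deform_bracket Theta I)^~ Y).
Proof.
move=> a X X'; rewrite /deform_bracket Endo_app_linear.
rewrite !(bracket_linear_l Theta) Endo_app_linear.
exact: linear_combination3.
Qed.

Fact deform_bracket_linear_r Theta I X :
  linear (deform_bracket Theta I X).
Proof.
move=> a Y Y'; rewrite /deform_bracket Endo_app_linear.
rewrite !(bracket_linear_r Theta) Endo_app_linear.
exact: linear_combination3.
Qed.

Definition deform Theta I : prestructure E :=
  PreStructure (anchor_comp (anc Theta) I)
    (@deform_bracket_linear_l Theta I) (@deform_bracket_linear_r Theta I).

Fact scale_bracket_linear_l (c : R) Theta Y :
  linear (fun X => c *: bracket Theta X Y).
Proof.
by move=> a X X'; rewrite bracket_linear_l scalerDr !scalerA mulrC.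
Qed.

Fact scale_bracket_linear_r (c : R) Theta X :
  linear (fun Y => c *: bracket Theta X Y).
Proof.
by move=> a Y Y'; rewrite bracket_linear_r scalerDr !scalerA mulrC.
Qed.

Definition scale_structure (c : R) Theta : prestructure E :=
  PreStructure (anchor_scale c (anc Theta))
    (@scale_bracket_linear_l c Theta) (@scale_bracket_linear_r c Theta).

Definition torsion Theta I X Y : Sec E :=
  bracket Theta (Endo_app I X) (Endo_app I Y)
  - Endo_app I (deform_bracket Theta I X Y).

Definition torsion_free Theta I := forall X Y, torsion Theta I X Y = 0.

End Deformation.

Section Structures.
Variables (R : realType) (n : nat) (M : manifold R n) (r : nat).
Variables (E : vbundle M r) (g : metric E) (Theta : prestructure E).
Implicit Types (I J G : Endo E).

(* J = I^*; the transpose is unique by non-degeneracy. *)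
Definition is_transpose I J :=
  forall p (u v : E p), metric_form g (J p u) v = metric_form g u (I p v).

Definition symmetric_endo I := is_transpose I I.
Definition skew_symmetric_endo I := is_transpose I (- I).
Definition orthogonal_endo I :=
  exists2 J, is_transpose I J & I \oE J = Endo_id E.

(* The indices 1, 2, 3 of the structures below are read in Z/3Z, so that the
   index 3 is 0 : 'Z_3. *)
Definition eps_hypersymplectic (eps : 'Z_3 -> R) (S : 'Z_3 -> Endo E) :=
  [/\ forall i, skew_symmetric_endo (S i),
      forall i, S i \oE S i = eps i *: Endo_id E,
      forall i j, i != j ->
        S i \oE S j = (eps 1 * eps 2 * eps 3) *: (S j \oE S i) &
      forall i, deform (deform Theta (S i)) (S i)
                = scale_structure (eps i) Theta].

Definition complex_structure J :=
  J \oE J = - Endo_id E /\ torsion_free Theta J.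

Definition para_complex_structure J :=
  J \oE J = Endo_id E /\ torsion_free Theta J.

Definition pseudo_metric G := symmetric_endo G /\ orthogonal_endo G.

Definition hermitian_pair J G :=
  [/\ complex_structure J, pseudo_metric G &
      forall X Y : Sec E,
        pairing g (Endo_app G (Endo_app J X)) (Endo_app J Y)
        = pairing g (Endo_app G X) Y].

Definition para_hermitian_pair J G :=
  [/\ para_complex_structure J, pseudo_metric G &
      forall X Y : Sec E,
        pairing g (Endo_app G (Endo_app J X)) (Endo_app J Y)
        = - pairing g (Endo_app G X) Y].

Definition hyperkahler (T : 'Z_3 -> Endo E) (G : Endo E) :=
  [/\ pseudo_metric G,
      [/\ complex_structure (T 1), complex_structure (T 2),
          T 1 \oE T 2 = - (T 2 \oE T 1) & T 3 = T 1 \oE T 2],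
      hermitian_pair (T 1) G /\ hermitian_pair (T 2) G &
      forall j, torsion_free Theta (G \oE T j)].

Definition para_hyperkahler (T : 'Z_3 -> Endo E) (G : Endo E) :=
  [/\ pseudo_metric G,
      [/\ para_complex_structure (T 1), para_complex_structure (T 2),
          T 1 \oE T 2 = - (T 2 \oE T 1) & T 3 = T 1 \oE T 2],
      para_hermitian_pair (T 1) G /\ para_hermitian_pair (T 2) G &
      forall j, torsion_free Theta (G \oE T j)].

End Structures.

Definition eps_hyper (R : realType) : 'Z_3 -> R := fun=> -1.
Definition eps_para (R : realType) : 'Z_3 -> R :=
  fun i => if i == 3 then -1 else 1.

Definition hypersymplectic R n (M : manifold R n) r (E : vbundle M r) g Theta
  (S : 'Z_3 -> Endo E) := eps_hypersymplectic g Theta (@eps_hyper R) S.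
Definition para_hypersymplectic R n (M : manifold R n) r (E : vbundle M r) g
  Theta (S : 'Z_3 -> Endo E) := eps_hypersymplectic g Theta (@eps_para R) S.

Definition T_of_S R n (M : manifold R n) r (E : vbundle M r)
    (eps : 'Z_3 -> R) (S : 'Z_3 -> Endo E) : 'Z_3 -> Endo E :=
  fun i => eps (i - 1) *: (S (i - 1) \oE S (i + 1)).

Definition G_of_S R n (M : manifold R n) r (E : vbundle M r)
    (S : 'Z_3 -> Endo E) : Endo E := S 3 \oE S 2 \oE S 1.

Definition S_of_TG R n (M : manifold R n) r (E : vbundle M r)
    (eps : 'Z_3 -> R) (T : 'Z_3 -> Endo E) (G : Endo E) : 'Z_3 -> Endo E :=
  fun i => (eps i * eps (i - 1)) *: (G \oE T i).

(* Main.v *)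
(* Both cases are treated at once with signs (d, d, -1), where d = -1 in the
   hypersymplectic case and d = 1 in the para-hypersymplectic case.

   If S^2 = e id, then Theta_{S,S} = 2 T_Theta(S) + e Theta, so that condition
   (iii) says that the torsion of S vanishes.  For anticommuting I, J whose
   squares are scalar, the torsion of IJ is a combination of those of I and J;
   this gives the integrability of T_1 and T_2.  The remaining conditions are
   identities between products of anticommuting endomorphisms.  In (b), the
   compatibility of G with T_j is only known on global sections; bump functions
   produce a section through every vector, and then skew-symmetry of T_j turns
   the compatibility into G T_j = T_j G. *)
From HB Require Import structures.
From mathcomp Require Import all_boot all_order all_algebra ring lra.
From mathcomp Require Import all_classical all_reals all_analysis.
Require Import Defs.

Set Implicit Arguments.
Unset Strict Implicit.
Unset Printing Implicit Defensive.

Import Order.TTheory GRing.Theory Num.Theory.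
Import numFieldNormedType.Exports.

Local Open Scope classical_set_scope.
Local Open Scope ring_scope.

(** * Bump functions and sections *)

Section Flat.
Variable R : realType.
Implicit Types (p : {poly R}) (s t : R).

Lemma exprn_le_expR n s : 0 <= s -> s ^+ n <= n`!%:R * expR s.
Proof.
move=> s0; case: n => [|n].
  by rewrite expr0 fact0 mul1r (le_trans _ (expR_ge1Dx s)) // lerDl.
rewrite mulrC -ler_pdivrMr ?ltr0n ?fact_gt0 //.
by rewrite (le_trans _ (expR_ge1Dxn n s0)) // lerDr.
Qed.

Lemma horner_le_expR p :
  exists2 C, 0 <= C & forall s, 0 <= s -> `|p.[s]| <= C * expR s.
Proof.
(* Monomial by monomial: $s^i \le i!\, e^s$ for $s \ge 0$. *)
exists (\sum_(i < size p) `|p`_i| * (i`!)%:R) => [|s s0].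
  by apply: sumr_ge0 => i _; rewrite mulr_ge0.
rewrite horner_coef (le_trans (ler_norm_sum _ _ _)) // mulr_suml ler_sum // => i _.
by rewrite normrM normrX (ger0_norm s0) -mulrA ler_wpM2l // exprn_le_expR.
Qed.

(* A family stable under differentiation, hence consisting of smooth functions. *)
Definition flat p t : R := if 0 < t then p.[t^-1] * expR (- t^-1) else 0.

(** This quadratic bound forces the derivative at 0 to vanish. It is the exponential bound for $X^2
    p$ taken at $s = 1/t$. *)
Lemma flat_le_sqr p : exists2 C, 0 <= C & forall t, `|flat p t| <= C * t ^+ 2.
Proof.
have [C C0 pC] := horner_le_expR ('X^2 * p).
exists C => // t; rewrite /flat; case: ifPn => [t0|_]; last first.
  by rewrite normr0 mulr_ge0 // sqr_ge0.
have := pC _ (ltW (divr_gt0 ltr01 t0)); rewrite mul1r hornerM hornerXn.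
rewrite [`|_ * p.[_]|]normrM [`|p.[_] * _|]normrM (gtr0_norm (expR_gt0 _)).
rewrite ger0_norm ?sqr_ge0 // exprVn.
rewrite ler_pdivrMl ?exprn_gt0 // expRN => h.
by rewrite ler_pdivrMr ?expR_gt0 // -mulrA mulrCA.
Qed.

(** For $t > 0$ the derivative of $p(1/t)e^{-1/t}$ is $t^{-2}(p - p')(1/t)\,e^{-1/t}$, again of the
    form [flat q]. For $t < 0$ everything is locally zero. *)
Lemma is_derive_flat p t :
  is_derive t (1 : R) (flat p) (flat ('X^2 * (p - p^`())) t).
Proof.
have [t0|t0|->] := ltrgtP t 0.
- rewrite [X in is_derive _ _ _ X]/flat ltNge (ltW t0) /=.
  apply: (@near_eq_is_derive _ _ _ (cst 0)) => //.
  near=> x; rewrite /flat ifF //; apply/negbTE; rewrite -leNgt ltW //.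
  by near: x; exact: lt_nbhsl.
- rewrite [X in is_derive _ _ _ X]/flat t0.
  apply: (@near_eq_is_derive R R R (fun x : R => p.[x^-1] * expR (- x^-1))).
    near=> x; rewrite /flat ifT //; near: x; exact: lt_nbhsr.
  have dV : is_derive t (1 : R) (fun x : R => x^-1) (- t ^- 2).
    rewrite -[- t ^- 2]mulr1; apply: is_deriveV; exact: lt0r_neq0.
  have dN : is_derive t (1 : R) (fun x : R => - x^-1) (t ^- 2).
    by rewrite -[t ^- 2]opprK; exact: is_deriveN.
  have dp : is_derive t (1 : R) (fun x => p.[x^-1]) (p^`().[t^-1] * - t ^- 2).
    exact: (@is_derive1_comp _ (horner p) (fun x => x^-1)).
  have de : is_derive t (1 : R) (fun x => expR (- x^-1)) (expR (- t^-1) * t ^- 2).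
    exact: (@is_derive1_comp _ expR (fun x => - x^-1)).
  have := is_deriveM dp de; set D := (X in is_derive _ _ _ X -> _).
  suff -> : D = ('X^2 * (p - p^`())).[t^-1] * expR (- t^-1) by [].
  rewrite /D hornerM hornerXn hornerD hornerN exprVn /GRing.scale /=; ring.
(* At the origin the difference quotient is at most $C|h|$ in absolute value; $C + 1$ replaces $C$
   below to have a positive divisor. *)
- have [C C0 pC] := flat_le_sqr p.
  rewrite [X in is_derive _ _ _ X]/flat ltxx.
  have h : (fun h => h^-1 *: ((flat p \o shift 0) (h *: (1 : R)) - flat p 0))
      @ 0^' --> (0 : R).
    have C1 : 0 < C + 1 by rewrite ltr_wpDl.
    apply/cvgr0Pnorm_le => e e0; near=> h.
    rewrite /= addr0 {2}/flat ltxx subr0 scaler1 /GRing.scale /= normrM normfV.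
    have h0 : h != 0 by near: h; exact: nbhs_dnbhs_neq.
    rewrite ler_pdivrMl ?normr_gt0 // (le_trans (pC h)) //.
    rewrite -real_normK ?num_real // expr2 mulrCA ler_wpM2l //.
    rewrite (le_trans (ler_wpM2r (normr_ge0 _) _ : _ <= (C + 1) * `|h|)) ?lerDl //.
    rewrite -ler_pdivlMl //; near: h; apply: dnbhs0_le.
    by rewrite mulr_gt0 ?invr_gt0.
  by apply: DeriveDef; [exact: cvgP h|exact: cvg_lim h].
Unshelve. all: by end_near. Qed.

End Flat.

(** * Flat functions composed with smooth functions *)

Section SmoothComposition.
Variables (R : realType) (V : normedModType R).
Implicit Types (U : set V) (f g u : V -> R) (p : {poly R}).

(** Bounding the order permits an induction on [k]: a derivative of [flat p \o u] is a product with
    a factor [flat q \o u] of the same family, which only has to be smooth to one order less. *)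
Definition smooth_upto k U f := forall vs, (size vs <= k)%N ->
  forall x, U x -> differentiable (iter_derive vs f) x.

Lemma smooth_uptoW k U f : smooth_upto k.+1 U f -> smooth_upto k U f.
Proof. by move=> sf vs szvs; apply: sf; exact: leqW. Qed.

Lemma smooth_upto_derive k U f v :
  smooth_upto k.+1 U f -> smooth_upto k U ('D_v f).
Proof. by move=> sf vs szvs; exact: (sf (v :: vs)). Qed.

Lemma smooth_uptoS k U f : (forall x, U x -> differentiable f x) ->
  (forall v, smooth_upto k U ('D_v f)) -> smooth_upto k.+1 U f.
Proof. by move=> df Df [|v vs] szvs //= x Ux; exact: Df. Qed.

Lemma smooth_upto_ext k U f g : open U -> (forall x, U x -> f x = g x) ->
  smooth_upto k U f -> smooth_upto k U g.
Proof.
move=> oU fg sf vs szvs x Ux.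
exact: (differentiable_iter_derive_ext oU Ux fg (sf vs szvs x Ux)).
Qed.

Lemma smooth_uptoD k U f g : open U ->
  smooth_upto k U f -> smooth_upto k U g -> smooth_upto k U (f + g).
Proof.
move=> oU; elim: k f g => [|k IH] f g sf sg.
  by case=> // _ x Ux; apply: differentiableD; [exact: (sf [::])|exact: (sg [::])].
apply: smooth_uptoS => [x Ux|v].
  by apply: differentiableD; [exact: (sf [::])|exact: (sg [::])].
apply: (smooth_upto_ext oU _ (IH _ _
  (@smooth_upto_derive _ _ _ v sf) (@smooth_upto_derive _ _ _ v sg))).
move=> x Ux; rewrite deriveD //; apply: diff_derivable.
- exact: (sf [::]).
- exact: (sg [::]).
Qed.

Lemma smooth_uptoM k U f g : open U ->
  smooth_upto k U f -> smooth_upto k U g -> smooth_upto k U (f * g).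
Proof.
move=> oU; elim: k f g => [|k IH] f g sf sg.
  by case=> // _ x Ux; apply: differentiableM; [exact: (sf [::])|exact: (sg [::])].
apply: smooth_uptoS => [x Ux|v].
  by apply: differentiableM; [exact: (sf [::])|exact: (sg [::])].
apply: (smooth_upto_ext oU _ (smooth_uptoD oU
  (IH _ _ (smooth_uptoW sf) (@smooth_upto_derive _ _ _ v sg))
  (IH _ _ (smooth_uptoW sg) (@smooth_upto_derive _ _ _ v sf)))).
move=> x Ux; rewrite deriveM //; apply: diff_derivable.
- exact: (sf [::]).
- exact: (sg [::]).
Qed.

Lemma differentiable_flat p (t : R) : differentiable (flat p) t.
Proof. by apply/derivable1_diffP; have [] := is_derive_flat p t. Qed.

Lemma derive_flat_comp p u v x : differentiable u x ->
  'D_v (flat p \o u) x = (flat ('X^2 * (p - p^`())) \o u) x * 'D_v u x.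
Proof.
move=> du; have df := differentiable_flat p (u x).
rewrite !deriveE //; last exact: differentiable_comp.
rewrite diff_comp //= diff1E //= derive1E.
have -> := @derive_val _ _ _ _ _ _ _ (is_derive_flat p (u x)).
by rewrite /GRing.scale /= mulrC.
Qed.

Lemma smooth_on_flat U u p : open U -> smooth_on U u -> smooth_on U (flat p \o u).
Proof.
move=> oU su.
have df q x : U x -> differentiable (flat q \o u) x.
  by move=> Ux; apply: differentiable_comp; [exact: (su [::])|exact: differentiable_flat].
suff h k q : smooth_upto k U (flat q \o u) by move=> vs; exact: (h (size vs)).
(* The polynomial is kept general, since the chain rule replaces [q] by $X^2(q - q')$. *)
elim: k q => [|k IH] q; first by case=> // _; exact: df.
apply: smooth_uptoS => [x|v]; first exact: df.
have sDu : smooth_upto k U ('D_v u).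
  by move=> vs _; exact: (smooth_on_derive v su).
apply: (smooth_upto_ext oU _ (smooth_uptoM oU (IH _) sDu)) => x Ux.
by rewrite derive_flat_comp //; exact: (su [::]).
Qed.

End SmoothComposition.

Lemma smooth_on_prod (R : realType) (V : normedModType R) (U : set V) (I : Type)
    (s : seq I) (F : I -> V -> R) : open U ->
  (forall i, smooth_on U (F i)) -> smooth_on U (fun x => \prod_(i <- s) F i x).
Proof.
move=> oU sF; elim: s => [|i s IH].
  apply: (smooth_on_ext oU _ (@smooth_on_cst _ _ U 1)) => x _.
  by rewrite big_nil.
apply: (smooth_on_ext oU _ (smooth_onM oU (sF i) IH)) => x _.
by rewrite big_cons.
Qed.

(** * Bump functions on a manifold and extension of a vector to a section *)

Section Bump.
Variables (R : realType) (n : nat).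

(** A closed ball of the sup norm, written as a product of segments so that its compactness is that
    of a product. *)
Definition cube (a : 'rV[R]_n) (e : R) : set 'rV[R]_n :=
  [set x | forall i, x 0 i \in `[a 0 i - e, a 0 i + e]].

Lemma cube_compact a e : compact (cube a e).
Proof.
have := @rV_compact R n (fun i => [set` `[a 0 i - e, a 0 i + e]]) _.
by apply=> i; exact: segment_compact.
Qed.

Lemma cube_sub_ball a e : 0 < e -> cube a (e / 2) `<=` ball a e.
Proof.
move=> e0 x xa; split=> // i j; rewrite ord1; have := xa j; rewrite in_itv /= => /andP[ax xa'].
by rewrite /ball /= ltr_distlC; apply/andP; split; lra.
Qed.

(** Each factor is nonzero exactly when $|x_i - a_i| < e$. *)
Definition cube_bump (a : 'rV[R]_n) (e : R) (x : 'rV[R]_n) : R :=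
  \prod_i (flat 1 (e - (x 0 i - a 0 i)) * flat 1 (e + (x 0 i - a 0 i))).

Lemma flat1_eq0 (t : R) : (flat 1 t == 0) = (t <= 0).
Proof.
rewrite /flat; case: ltP => [t0|]; last by rewrite eqxx.
by rewrite hornerC mul1r gt_eqF ?expR_gt0.
Qed.

Lemma cube_bump_center a e : 0 < e -> cube_bump a e a != 0.
Proof.
move=> e0; apply/prodf_neq0 => i _.
by rewrite subrr subr0 addr0 mulf_neq0 // flat1_eq0 -ltNge.
Qed.

Lemma cube_bump_out a e x : ~ cube a e x -> cube_bump a e x = 0.
Proof.
move=> nax; apply/eqP; apply: contra_notT nax => /prodf_neq0 xne0 i.
have := xne0 i isT; rewrite mulf_eq0 !flat1_eq0 negb_or -!ltNge => /andP[h1 h2].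
by rewrite in_itv /=; apply/andP; split; lra.
Qed.

Lemma smooth_on_cube_bump (V : normedModType R) (U : set V) (u : V -> 'rV[R]_n) a e :
  open U -> (forall i, smooth_on U (fun x => u x 0 i)) ->
  smooth_on U (cube_bump a e \o u).
Proof.
move=> oU su; apply: smooth_on_prod => // i.
have sD : smooth_on U (fun x => u x 0 i - a 0 i).
  exact: (smooth_onD oU (su i) (@smooth_on_cst _ _ U (- a 0 i))).
have sN : smooth_on U (fun x => - (u x 0 i - a 0 i)).
  apply: (smooth_on_ext oU _ (smooth_onM oU (@smooth_on_cst _ _ U (-1)) sD)) => x _.
  by rewrite !fctE mulN1r.
apply: (smooth_onM oU).
- exact: (smooth_on_flat 1 oU (smooth_onD oU (@smooth_on_cst _ _ U e) sN)).
- exact: (smooth_on_flat 1 oU (smooth_onD oU (@smooth_on_cst _ _ U e) sD)).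
Qed.

Variable M : manifold R n.

Lemma msmooth_local (U : set M) (f : M -> R) :
  (forall p, U p -> exists2 W, W p & msmooth W f) -> msmooth U f.
Proof.
move=> sf c ac vs x [cx Ux]; have [W Wx sfW] := sf _ Ux; exact: (sfW c).
Qed.

Lemma bump_function (p : M) (W : set M) : open W -> W p ->
  exists f K, [/\ msmooth setT f, f p != 0, closed K, K `<=` W &
    forall q, ~ K q -> f q = 0].
Proof.
move=> oW Wp; have [c ac cp] := atlas_cover p.
pose a := chart_map c p.
have : nbhs a (chart_cod c `&` chart_inv c @^-1` W).
  apply: open_nbhs_nbhs; split; first exact: chart_pre_open.
  by split; [exact: chart_mapP|rewrite /= /a chart_mapK].
move=> /nbhs_ballP[e /= e0 aeW].
have cubeW := subset_trans (cube_sub_ball e0) aeW.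
have e20 : 0 < e / 2 by rewrite divr_gt0.
pose K := chart_inv c @` cube a (e / 2).
(* The bump in the chart, extended by zero. Its support lies in [K], a compact set, hence closed
   because the manifold is Hausdorff. *)
pose f q := if `[< chart_dom c q >] then cube_bump a (e / 2) (chart_map c q) else 0.
have f0 q : ~ K q -> f q = 0.
  move=> nKq; rewrite /f; case: asboolP => // cq; apply: cube_bump_out => qa.
  by apply: nKq; exists (chart_map c q) => //; rewrite chart_mapK.
have clK : closed K.
  apply: compact_closed; first exact: manifold_hausdorff.
  apply: continuous_compact; last exact: cube_compact.
  apply: continuous_in_subspaceT => x /set_mem /cubeW[cx _].
  exact: chart_inv_continuous.
exists f, K; split=> //.
(* At points of [K] smoothness is read in the chart [c] through the transition maps; off [K], an
   open set, [f] is zero. *)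
- apply: msmooth_local => q _; have [Kq|nKq] := pselect (K q).
    have cq : chart_dom c q by case: Kq => x /cubeW[cx _] <-; exact: chart_invP.
    exists (chart_dom c) => // d ad.
    have oU := @chart_pre_open _ _ _ d _ (@chart_dom_open _ _ _ c).
    apply: (smooth_on_ext oU _ (smooth_on_cube_bump a (e / 2) oU
      (@atlas_compatible _ _ M d c ad ac))) => x [_ cx] /=.
    by rewrite /f; case: asboolP.
  exists (~` K) => //.
  have oK : open (~` K) by exact: closed_openC.
  by apply: (msmooth_ext oK _ (@msmooth_cst _ _ _ (~` K) 0)) => x nKx; rewrite f0.
- by rewrite /f; case: asboolP => // _; exact: cube_bump_center.
- by move=> _ [x /cubeW[_ Wx] <-].
Qed.

Lemma section_through r (E : vbundle M r) p (v : E p) : exists X : Sec E, X p = v.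
Proof.
have [e fe ep] := frames_cover E p; have oe := @frame_dom_open _ _ _ _ _ e.
have [f [K [sf fp0 clK Ke f0]]] := bump_function oe ep.
(* The coordinates of [v] are kept constant in the frame and cut off by [f]; dividing by [f p]
   restores the value [v] at [p]. *)
pose s q : E q := if `[< frame_dom e q >] then
  f q *: \sum_j (frame_coord e j v / f p) *: tnth (frame_vec e q) j else 0.
have ss e' : frames e' -> forall i,
    msmooth (frame_dom e') (fun q => frame_coord e' i (s q)).
  move=> fe' i; have oe' := @frame_dom_open _ _ _ _ _ e'.
  have oI : open (frame_dom e' `&` frame_dom e) by exact: openI.
  apply: msmooth_local => q e'q; have [Kq|nKq] := pselect (K q).
    exists (frame_dom e' `&` frame_dom e); first by split=> //; exact: Ke.
    have sI : msmooth (frame_dom e' `&` frame_dom e) f by exact: msmoothS sf.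
    have sj j : msmooth (frame_dom e' `&` frame_dom e) (fun q =>
        frame_coord e j v / f p * frame_coord e' i (tnth (frame_vec e q) j)).
      exact: (msmoothM oI (@msmooth_cst _ _ _ _ _) (frames_compatible fe' fe i j)).
    apply: (msmooth_ext oI _ (msmoothM oI sI
      (msmooth_sum (index_enum 'I_r) oI sj))) => x [_ ex].
    rewrite /s; case: asboolP => // _; rewrite !fctE /frame_coord.
    rewrite linearZ linear_sum /=; congr (_ * _); apply: eq_bigr => j _.
    by rewrite linearZ.
  have oK : open (frame_dom e' `&` ~` K) by apply: openI => //; exact: closed_openC.
  exists (frame_dom e' `&` ~` K) => //.
  apply: (msmooth_ext oK _ (@msmooth_cst _ _ _ _ 0)) => x [_ nKx].
  by rewrite /s f0 // scale0r if_same /frame_coord linear0.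
exists (mkSec ss) => /=; rewrite /Sec_eval /= /s; case: asboolP => // _.
rewrite scaler_sumr [RHS](frame_decomp v ep); apply: eq_bigr => j _.
by rewrite scalerA mulrCA divff // mulr1.
Qed.

End Bump.

(** * Torsion and deformation *)

(** Turns identities between vectors of a fibre into identities between reals, which [ring] can
    decide. *)
Lemma vect_coordP (R : realType) (V : vectType R) (u v : V) :
  (forall i, coord (vbasis fullv) i u = coord (vbasis fullv) i v) -> u = v.
Proof.
move=> uv; rewrite (coord_vbasis (memvf u)) (coord_vbasis (memvf v)).
by apply: eq_bigr => i _; rewrite uv.
Qed.

Section BilinearTorsion.
Variables (R : realType) (V : lmodType R) (B : V -> V -> V).
Hypotheses (BNl : forall x y, B (- x) y = - B x y)
  (BNr : forall x y, B x (- y) = - B x y).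

Let N (I : V -> V) x y := B (I x) (I y) - I (B (I x) y + B x (I y) - I (B x y)).

(* When I^2 = a, J^2 = b and I J = - J I,
   2 N_{IJ}(x, y) = N_I(Jx, Jy) - J N_I(Jx, y) - J N_I(x, Jy) - b N_I(x, y)
                  + N_J(Ix, Iy) - I N_J(Ix, y) - I N_J(x, Iy) - a N_J(x, y);
   no symmetry or Jacobi identity of B is involved. *)
Lemma bilinear_torsion_comp (a b : R) (I J : V -> V) (l : V -> R) :
  linear I -> linear J -> scalar l ->
  (forall x, I (I x) = a *: x) -> (forall x, J (J x) = b *: x) ->
  (forall x, J (I x) = - I (J x)) ->
  (forall x y, N I x y = 0) -> (forall x y, N J x y = 0) ->
  forall x y, l (N (I \o J) x y) = 0.
Proof.
move=> linI linJ linl II JJ JI NI NJ x y.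
have l0 : l 0 = 0 by have := linl (-1) 0 0; rewrite scaler0 addr0 mulN1r addNr.
have lD u v : l (u + v) = l u + l v by rewrite -[u]scale1r linl mul1r scale1r.
have lZ c u : l (c *: u) = c * l u by rewrite -[c *: u]addr0 linl l0 addr0.
have lN u : l (- u) = - l u by rewrite -scaleN1r lZ mulN1r.
have I0 : I 0 = 0 by have := linI (-1) 0 0; rewrite scaler0 addr0 scaleN1r addNr.
have ID u v : I (u + v) = I u + I v by rewrite -[u]scale1r linI !scale1r.
have IZ c u : I (c *: u) = c *: I u by rewrite -[c *: u]addr0 linI I0 addr0.
have IN u : I (- u) = - I u by rewrite -scaleN1r IZ scaleN1r.
have J0 : J 0 = 0 by have := linJ (-1) 0 0; rewrite scaler0 addr0 scaleN1r addNr.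
have JD u v : J (u + v) = J u + J v by rewrite -[u]scale1r linJ !scale1r.
have JZ c u : J (c *: u) = c *: J u by rewrite -[c *: u]addr0 linJ J0 addr0.
have JN u : J (- u) = - J u by rewrite -scaleN1r JZ scaleN1r.
(* The eight torsions of the formula, each mapped to a real by [l]. The factors [a] and [b] are put
   in beforehand, so that only a linear combination with rational coefficients remains for [lra]. *)
have := congr1 l (NI (J x) (J y)).
have := congr1 (l \o J) (NI (J x) y).
have := congr1 (l \o J) (NI x (J y)).
have := congr1 ( *%R b \o l) (NI x y).
have := congr1 l (NJ (I x) (I y)).
have := congr1 (l \o I) (NJ (I x) y).
have := congr1 (l \o I) (NJ x (I y)).
have := congr1 ( *%R a \o l) (NJ x y).
rewrite /N /= ?(I0, J0, l0, mulr0).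
do ?[progress rewrite ?(JI, II, JJ, ID, IN, IZ, JD, JN, JZ, BNl, BNr)].
rewrite ?(lD, lN, lZ) => f4 f3 f2 f1 e4 e3 e2 e1.
lra.
Qed.

End BilinearTorsion.

(** * Torsion and double deformation by endomorphisms of the bundle *)

Section EndoAlgebra.
Variables (R : realType) (n : nat) (M : manifold R n) (r : nat).
Variable E : vbundle M r.
Implicit Types (I J : Endo E) (X Y : Sec E) (Theta : prestructure E).

Lemma endoP I J : (forall p (u : E p), I p u = J p u) -> I = J.
Proof. by move=> IJ; apply/val_inj/fiberwiseP => p; apply/lfunP => u; exact: IJ. Qed.

Lemma secP X Y : (forall p, X p = Y p) -> X = Y.
Proof. by move=> XY; apply/val_inj/fiberwiseP. Qed.

Lemma endo_compE I J p (u : E p) : (I \oE J) p u = I p (J p u).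
Proof. exact: comp_lfunE. Qed.

Lemma endo_idE p (u : E p) : (Endo_id E) p u = u.
Proof. exact: id_lfunE. Qed.

Lemma endo_scaleE c I p (u : E p) : (c *: I : Endo E) p u = c *: I p u.
Proof. exact: scale_lfunE. Qed.

Lemma endo_oppE I p (u : E p) : (- I : Endo E) p u = - I p u.
Proof. exact: opp_lfunE. Qed.

Lemma endo_appE I X p : Endo_app I X p = I p (X p).
Proof. by []. Qed.

Lemma sec_addE X Y p : (X + Y : Sec E) p = X p + Y p.
Proof. by []. Qed.

Lemma sec_oppE X p : (- X : Sec E) p = - X p.
Proof. by []. Qed.

Lemma sec_scaleE c X p : (c *: X : Sec E) p = c *: X p.
Proof. by []. Qed.

HB.instance Definition _ I :=
  GRing.isLinear.Build R (Sec E) (Sec E) *:%R (Endo_app I) (@Endo_app_linear _ _ _ _ E I).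

(** The data agree by functional extensionality, the proofs of linearity and smoothness by proof
    irrelevance. *)
Lemma prestructureP Theta Theta' :
  (forall p (u : E p), anchor_fun (anc Theta) u = anchor_fun (anc Theta') u) ->
  (forall X Y, bracket Theta X Y = bracket Theta' X Y) -> Theta = Theta'.
Proof.
case: Theta Theta' => [[a la sa] b lb rb] [[a' la' sa'] b' lb' rb'] /= aa' bb'.
have ea : a = a'.
  by apply: functional_extensionality_dep => p; apply: funext => u; exact: aa'.
have eb : b = b' by apply: funext => X; apply: funext => Y; exact: bb'.
subst a' b'.
by rewrite (Prop_irrelevance la la') (Prop_irrelevance sa sa')
  (Prop_irrelevance lb lb') (Prop_irrelevance rb rb').
Qed.

Section Torsion.
Variable Theta : prestructure E.
Local Notation "[< X , Y >]" := (bracket Theta X Y).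

Lemma bracketDl X X' Y : [<X + X', Y>] = [<X, Y>] + [<X', Y>].
Proof. by have := bracket_linear_l Theta Y 1 X X'; rewrite !scale1r. Qed.

Lemma bracket0l Y : [<0, Y>] = 0.
Proof. by apply: (addIr [<0, Y>]); rewrite -bracketDl !add0r. Qed.

Lemma bracketZl c X Y : [<c *: X, Y>] = c *: [<X, Y>].
Proof.
by have := bracket_linear_l Theta Y c X 0; rewrite !addr0 bracket0l addr0.
Qed.

Lemma bracketNl X Y : [<- X, Y>] = - [<X, Y>].
Proof. by rewrite -scaleN1r bracketZl scaleN1r. Qed.

Lemma bracketDr X Y Y' : [<X, Y + Y'>] = [<X, Y>] + [<X, Y'>].
Proof. by have := bracket_linear_r Theta X 1 Y Y'; rewrite !scale1r. Qed.

Lemma bracket0r X : [<X, 0>] = 0.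
Proof. by apply: (addIr [<X, 0>]); rewrite -bracketDr !add0r. Qed.

Lemma bracketZr c X Y : [<X, c *: Y>] = c *: [<X, Y>].
Proof.
by have := bracket_linear_r Theta X c Y 0; rewrite !addr0 bracket0r addr0.
Qed.

Lemma bracketNr X Y : [<X, - Y>] = - [<X, Y>].
Proof. by rewrite -scaleN1r bracketZr scaleN1r. Qed.

(** The torsion is quadratic in the endomorphism: scaling [I] by $c$ multiplies it by $c^2$. *)
Lemma torsion_freeZ c I : torsion_free Theta I -> torsion_free Theta (c *: I).
Proof.
move=> tI X Y.
have appZ Z : Endo_app (c *: I) Z = c *: Endo_app I Z.
  by apply: secP => p; exact: endo_scaleE.
have := tI X Y => /(congr1 (fun Z => (c * c) *: Z)).
rewrite scaler0 => <-; rewrite /torsion /deform_bracket !appZ.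
rewrite !(bracketZl, bracketZr) -scalerDr -!scalerBr linearZ /= -scalerBr.
by rewrite scalerA.
Qed.

Lemma endo_sqr_app c I X : I \oE I = c *: Endo_id E ->
  Endo_app I (Endo_app I X) = c *: X.
Proof.
move=> II; apply: secP => p; rewrite !endo_appE -endo_compE II.
by rewrite endo_scaleE endo_idE.
Qed.

(** In the expanded double deformation the terms containing $I^2$ add up to $3c[X,Y]$, of which
    $2c[X,Y]$ belongs to twice the torsion. *)
Lemma deform2_bracket c I X Y : I \oE I = c *: Endo_id E ->
  bracket (deform (deform Theta I) I) X Y
  = 2 *: torsion Theta I X Y + c *: [<X, Y>].
Proof.
move=> II; rewrite /= /deform_bracket /= /torsion /deform_bracket.
rewrite !(linearD, linearN) /= !(endo_sqr_app _ II) !(bracketZl, bracketZr).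
apply: secP => p; apply: vect_coordP => i.
have lD (u v : E p) : coord (vbasis fullv) i (u + v) =
  coord (vbasis fullv) i u + coord (vbasis fullv) i v by exact: linearD.
have lN (u : E p) : coord (vbasis fullv) i (- u) = - coord (vbasis fullv) i u.
  exact: linearN.
have lZ a (u : E p) : coord (vbasis fullv) i (a *: u) =
  a * coord (vbasis fullv) i u by exact: linearZ.
rewrite !(sec_addE, sec_oppE, sec_scaleE) !(lD, lN, lZ).
ring.
Qed.

(** The anchors always agree, since $\rho I^2 = c\rho$; the brackets differ by twice the torsion. *)
Lemma deform2_eq_scale c I : I \oE I = c *: Endo_id E ->
  deform (deform Theta I) I = scale_structure c Theta <-> torsion_free Theta I.
Proof.
move=> II; split=> [eD X Y|tI].
  have := deform2_bracket X Y II; rewrite eD /= => /eqP.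
  rewrite -{1}[c *: _]add0r (inj_eq (addIr _)) eq_sym scaler_eq0 pnatr_eq0 /=.
  by move/eqP.
apply: prestructureP => [p u|X Y].
  rewrite /= -endo_compE II endo_scaleE endo_idE.
  have := anchor_linear (anc Theta) c u 0; rewrite addr0 => ->.
  suff -> : anchor_fun (anc Theta) (0 : E p) = 0 by rewrite addr0.
  by have := anchor_linear (anc Theta) (-1) (0 : E p) 0; rewrite scaler0 addr0 scaleN1r addNr.
by rewrite (deform2_bracket _ _ II) tI scaler0 add0r.
Qed.

Lemma torsion_free_comp a b I J :
  I \oE I = a *: Endo_id E -> J \oE J = b *: Endo_id E ->
  I \oE J = - (J \oE I) ->
  torsion_free Theta I -> torsion_free Theta J -> torsion_free Theta (I \oE J).
Proof.
move=> II JJ IJ tI tJ X Y.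
apply: secP => p; apply: vect_coordP => i; rewrite [RHS]linear0.
have appIJ Z : Endo_app (I \oE J) Z = Endo_app I (Endo_app J Z).
  by apply: secP => q; rewrite !endo_appE endo_compE.
rewrite /torsion /deform_bracket !appIJ.
(* The linear form on sections is a coordinate of the value at [p]. *)
refine (@bilinear_torsion_comp R (Sec E) (bracket Theta) bracketNl bracketNr a b
  (Endo_app I) (Endo_app J)
  (fun Z : Sec E => coord (vbasis fullv) i (Z p)) _ _ _ _ _ _ tI tJ X Y).
- exact: Endo_app_linear.
- exact: Endo_app_linear.
- by move=> c u v; rewrite sec_addE sec_scaleE linearP.
- by move=> Z; exact: endo_sqr_app.
- by move=> Z; exact: endo_sqr_app.
- move=> Z; apply: secP => q; rewrite sec_oppE !endo_appE -!endo_compE IJ.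
  by rewrite endo_oppE opprK.
Qed.

End Torsion.
End EndoAlgebra.

(** * Hypersymplectic and hyperkahler structures *)

Lemma Z3_ind (P : 'Z_3 -> Prop) : P 1 -> P 2 -> P 3 -> forall i, P i.
Proof.
move=> P1 P2 P3 [[|[|[|//]]] lti].
(* The residues come in the order 0, 1, 2, and [3] denotes 0. *)
- by rewrite (_ : Ordinal lti = 3) //; exact: val_inj.
- by rewrite (_ : Ordinal lti = 1) //; exact: val_inj.
- by rewrite (_ : Ordinal lti = 2) //; exact: val_inj.
Qed.

Section Structures.
Variables (R : realType) (n : nat) (M : manifold R n) (r : nat).
Variables (E : vbundle M r) (g : metric E) (Theta : prestructure E).
Implicit Types (I J G : Endo E) (d : R).

Local Notation "<< u , v >>" := (metric_form g u v).

Lemma endoN I p (u : E p) : I p (- u) = - I p u.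
Proof. exact: linearN. Qed.

Lemma endoZ I c p (u : E p) : I p (c *: u) = c *: I p u.
Proof. exact: linearZ. Qed.

Lemma metricDl p (u u' v : E p) : <<u + u', v>> = <<u, v>> + <<u', v>>.
Proof.
by have := metric_linear g v 1 u u'; rewrite scale1r mul1r !(metric_sym g v).
Qed.

Lemma metric0l p (v : E p) : <<0, v>> = 0.
Proof. by apply: (addIr <<0, v>>); rewrite -metricDl !add0r. Qed.

Lemma metricZl p c (u v : E p) : <<c *: u, v>> = c * <<u, v>>.
Proof.
have := metric_linear g v c u 0; rewrite !(metric_sym g v) !metric0l !addr0.
exact.
Qed.

Lemma metricNl p (u v : E p) : <<- u, v>> = - <<u, v>>.
Proof. by rewrite -scaleN1r metricZl mulN1r. Qed.

Lemma metricZr p c (u v : E p) : <<u, c *: v>> = c * <<u, v>>.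
Proof. by rewrite metric_sym metricZl metric_sym. Qed.

Lemma metricNr p (u v : E p) : <<u, - v>> = - <<u, v>>.
Proof. by rewrite metric_sym metricNl metric_sym. Qed.

Lemma metric_inj p (u u' : E p) : (forall v, <<u, v>> = <<u', v>>) -> u = u'.
Proof.
move=> uu'; apply/eqP; rewrite -subr_eq0; apply/eqP.
by apply: (@metric_nondegenerate _ _ _ _ _ g) => v; rewrite metricDl metricNl uu' subrr.
Qed.

Lemma skew_endoP I : skew_symmetric_endo g I <->
  forall p (u v : E p), <<I p u, v>> = - <<u, I p v>>.
Proof.
split=> sI p u v; have := sI p u v; rewrite ?(endo_oppE, metricNl).
  by move=> <-; rewrite opprK.
by move=> ->; rewrite opprK.
Qed.

(** By non-degeneracy the transpose provided by orthogonality must be [G] itself. *)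
Lemma pseudo_metric_involutive G : pseudo_metric g G -> G \oE G = Endo_id E.
Proof.
move=> [sG [J tJ GJ]]; rewrite -[RHS]GJ; congr (_ \oE _).
by apply: endoP => p u; apply: metric_inj => v; rewrite tJ sG.
Qed.

Definition eps_of d : 'Z_3 -> R := fun i => if i == 3 then -1 else d.

Definition signed_structure d J :=
  J \oE J = d *: Endo_id E /\ torsion_free Theta J.

(** The sign $-d$ is $+1$ in the hermitian case $d = -1$ and $-1$ in the para-hermitian case $d =
    1$. *)
Definition signed_pair d J G :=
  [/\ signed_structure d J, pseudo_metric g G &
      forall X Y : Sec E,
        pairing g (Endo_app G (Endo_app J X)) (Endo_app J Y)
        = - (d *: pairing g (Endo_app G X) Y)].

Definition signed_hyperkahler d (T : 'Z_3 -> Endo E) G :=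
  [/\ pseudo_metric g G,
      [/\ signed_structure d (T 1), signed_structure d (T 2),
          T 1 \oE T 2 = - (T 2 \oE T 1) & T 3 = T 1 \oE T 2],
      signed_pair d (T 1) G /\ signed_pair d (T 2) G &
      forall j, torsion_free Theta (G \oE T j)].

(** $\langle GJX, JY\rangle = -\langle JGJX, Y\rangle = -\langle GJ^2X, Y\rangle = -d\langle GX,
    Y\rangle$. *)
Lemma signed_pair_skew d J G : pseudo_metric g G ->
  signed_structure d J -> skew_symmetric_endo g J ->
  (forall p (u : E p), J p (G p u) = G p (J p u)) -> signed_pair d J G.
Proof.
move=> pG sJ /skew_endoP skJ JG; split=> // X Y; apply/val_inj/funext => p.
have [JJ _] := sJ.
rewrite /= !endo_appE -[LHS]opprK -skJ JG -(endo_compE J J) JJ endo_scaleE.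
by rewrite endo_idE linearZ metricZl.
Qed.

Lemma signed_pair_comm d J G : d * d = 1 ->
  (forall p (u : E p), exists X : Sec E, X p = u) ->
  skew_symmetric_endo g J -> signed_pair d J G ->
  forall p (u : E p), J p (G p u) = G p (J p u).
Proof.
move=> d2 secE /skew_endoP skJ [[JJ _] _ GJ] p u.
have JJE (v : E p) : J p (J p v) = d *: v.
  by rewrite -endo_compE JJ endo_scaleE endo_idE.
have JGJ (v : E p) : J p (G p (J p v)) = d *: G p v.
  apply: metric_inj => w; have [X <-] := secE p v; have [Y <-] := secE p w.
  have e : <<G p (J p (X p)), J p (Y p)>> = - (d * <<G p (X p), Y p>>).
    exact: (congr1 (fun f : Cinf M => f p) (GJ X Y)).
  by rewrite skJ metricZl e opprK.
by rewrite -[u in LHS]scale1r -d2 -scalerA -JJE !endoZ JGJ scalerA d2 scale1r.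
Qed.

Lemma signed_hyperkahlerN1 T G :
  signed_hyperkahler (-1) T G <-> hyperkahler g Theta T G.
Proof.
have e J : signed_structure (-1) J = complex_structure Theta J.
  by rewrite /signed_structure scaleN1r.
rewrite /signed_hyperkahler /signed_pair /hyperkahler /hermitian_pair !e.
split=> -[pG T12 [[? ? h1] [? ? h2]] tGT]; split=> //; split; split=> // X Y.
- by rewrite h1 scaleN1r opprK.
- by rewrite h2 scaleN1r opprK.
- by rewrite h1 scaleN1r opprK.
- by rewrite h2 scaleN1r opprK.
Qed.

Lemma signed_hyperkahler1 T G :
  signed_hyperkahler 1 T G <-> para_hyperkahler g Theta T G.
Proof.
have e J : signed_structure 1 J = para_complex_structure Theta J.
  by rewrite /signed_structure scale1r.
rewrite /signed_hyperkahler /signed_pair /para_hyperkahler /para_hermitian_pair.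
rewrite !e.
split=> -[pG T12 [[? ? h1] [? ? h2]] tGT]; split=> //; split; split=> // X Y.
- by rewrite h1 scale1r.
- by rewrite h2 scale1r.
- by rewrite h1 scale1r.
- by rewrite h2 scale1r.
Qed.

Lemma eps_ofE d : (eps_of d 1 = d) * (eps_of d 2 = d) * (eps_of d 3 = -1).
Proof. by []. Qed.

Lemma Z3E : ((1 - 1 : 'Z_3) = 3) * ((1 + 1 : 'Z_3) = 2) * ((2 - 1 : 'Z_3) = 1) *
  ((2 + 1 : 'Z_3) = 3) * ((3 - 1 : 'Z_3) = 2) * ((3 + 1 : 'Z_3) = 1).
Proof. by do !split; apply: val_inj. Qed.

(** * From (para-)hypersymplectic triplets to (para-)hyperkähler quadruples *)

Section FromHypersymplectic.
Variables (d : R) (S : 'Z_3 -> Endo E).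
Hypotheses (d2 : d * d = 1) (hS : eps_hypersymplectic g Theta (eps_of d) S).

Let T := T_of_S (eps_of d) S.
Let G := G_of_S S.

Let skewS i p (u v : E p) : <<S i p u, v>> = - <<u, S i p v>>.
Proof. by have [/(_ i)/skew_endoP] := hS. Qed.

Let sqrS i p (u : E p) : S i p (S i p u) = eps_of d i *: u.
Proof.
by rewrite -endo_compE; have [_ -> _ _] := hS; rewrite endo_scaleE endo_idE.
Qed.

(** The product of the three signs is $-d^2 = -1$ in both cases. *)
Let anti i j p (u : E p) : i != j -> S i p (S j p u) = - S j p (S i p u).
Proof.
move=> ij; rewrite -!endo_compE; have [_ _ -> // _] := hS.
by rewrite !eps_ofE d2 mul1r scaleN1r endo_oppE.
Qed.

Let anti31 p (u : E p) : S 3 p (S 1 p u) = - S 1 p (S 3 p u).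
Proof. exact: anti. Qed.
Let anti32 p (u : E p) : S 3 p (S 2 p u) = - S 2 p (S 3 p u).
Proof. exact: anti. Qed.
Let anti21 p (u : E p) : S 2 p (S 1 p u) = - S 1 p (S 2 p u).
Proof. exact: anti. Qed.

Let sqrS1 p (u : E p) : S 1 p (S 1 p u) = d *: u. Proof. exact: sqrS. Qed.
Let sqrS2 p (u : E p) : S 2 p (S 2 p u) = d *: u. Proof. exact: sqrS. Qed.
Let sqrS3 p (u : E p) : S 3 p (S 3 p u) = - u.
Proof. by rewrite sqrS eps_ofE scaleN1r. Qed.

Let T1E p (u : E p) : T 1 p u = S 2 p (S 3 p u).
Proof.
rewrite /T /T_of_S !Z3E !eps_ofE scaleN1r endo_oppE endo_compE.
by rewrite anti32 opprK.
Qed.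

Let T2E p (u : E p) : T 2 p u = d *: S 1 p (S 3 p u).
Proof.
by rewrite /T /T_of_S !Z3E !eps_ofE endo_scaleE endo_compE.
Qed.


Let T3E p (u : E p) : T 3 p u = - (d *: S 1 p (S 2 p u)).
Proof.
by rewrite /T /T_of_S !Z3E !eps_ofE endo_scaleE endo_compE anti21 scalerN.
Qed.

Let GE p (u : E p) : G p u = - S 1 p (S 2 p (S 3 p u)).
Proof.
by rewrite /G /G_of_S !endo_compE anti21 linearN /= anti31 opprK anti32 linearN.
Qed.

(** Normalises words in the [S i]: indices are sorted increasingly, with a sign for each exchange,
    and squares become scalars. *)
Let simpS := (endoN, endoZ, fun p => @scalerN R (E p),
  fun p => @opprK (E p), anti31, anti32, anti21, sqrS1, sqrS2, sqrS3,
  fun p => @scalerA R (E p), d2, fun p => @scale1r R (E p)).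

Let GT1 : G \oE T 1 = - d *: S 1.
Proof.
apply: endoP => p u; rewrite endo_compE T1E GE endo_scaleE scaleNr.
by rewrite !simpS.
Qed.

Let GT2 : G \oE T 2 = S 2.
Proof.
by apply: endoP => p u; rewrite endo_compE GE T2E !simpS.
Qed.

Let GT3 : G \oE T 3 = - d *: S 3.
Proof.
apply: endoP => p u; rewrite endo_compE T3E GE endo_scaleE scaleNr.
by rewrite !simpS.
Qed.

Let skewT1 : skew_symmetric_endo g (T 1).
Proof.
apply/skew_endoP => p u v.
by rewrite !T1E !skewS opprK anti32 metricNr.
Qed.

Let skewT2 : skew_symmetric_endo g (T 2).
Proof.
apply/skew_endoP => p u v.
by rewrite !T2E metricZl metricZr !skewS opprK anti31 metricNr mulrN.
Qed.

Let symG : symmetric_endo g G.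
Proof.
by move=> p u v; rewrite !GE metricNl metricNr !skewS !opprK !simpS metricNr.
Qed.

Let pseudoG : pseudo_metric g G.
Proof.
(* $G$ is its own transpose, and $(S_1S_2S_3)^2 = -S_1^2S_2^2S_3^2 = d^2 = 1$. *)
split=> //; exists G => //; apply: endoP => p u.
by rewrite endo_compE endo_idE !GE !simpS.
Qed.

Let torsionS i : torsion_free Theta (S i).
Proof.
have [_ /(_ i) SS _ /(_ i) dS] := hS.
exact/(deform2_eq_scale Theta SS).
Qed.

Let torsionT1 : torsion_free Theta (T 1).
Proof.
have -> : T 1 = S 2 \oE S 3 by apply: endoP => p u; rewrite T1E endo_compE.
have [_ SS aS _] := hS; apply: (torsion_free_comp (SS _) (SS _)) => //.
by apply: endoP => p u; rewrite endo_oppE !endo_compE anti32 opprK.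
Qed.

Let torsionT2 : torsion_free Theta (T 2).
Proof.
have -> : T 2 = d *: (S 1 \oE S 3).
  by apply: endoP => p u; rewrite T2E endo_scaleE endo_compE.
apply: torsion_freeZ.
have [_ SS aS _] := hS; apply: (torsion_free_comp (SS _) (SS _)) => //.
by apply: endoP => p u; rewrite endo_oppE !endo_compE anti31 opprK.
Qed.

Let structureT1 : signed_structure d (T 1).
Proof.
split=> //; apply: endoP => p u.
by rewrite endo_compE !T1E endo_scaleE endo_idE !simpS.
Qed.

Let structureT2 : signed_structure d (T 2).
Proof.
split=> //; apply: endoP => p u.
by rewrite endo_compE !T2E endo_scaleE endo_idE !simpS.
Qed.

Lemma hyperkahler_of_hypersymplectic :
  [/\ signed_hyperkahler d T G,
      skew_symmetric_endo g (T 1) /\ skew_symmetric_endo g (T 2) &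
      forall i, S i = S_of_TG (eps_of d) T G i].
Proof.
split=> //; last first.
  apply: Z3_ind; rewrite /S_of_TG !Z3E !eps_ofE.
  - by rewrite GT1 scalerA mulrN1 mulrNN d2 scale1r.
  - by rewrite GT2 d2 scale1r.
  - by rewrite GT3 scalerA mulN1r mulrNN d2 scale1r.
split=> //.
- split=> //; apply: endoP => p u.
  + by rewrite endo_oppE !endo_compE !T1E !T2E !simpS.
  + by rewrite endo_compE T3E T1E T2E !simpS.
(* Each $S_i$ anticommutes with exactly two factors of $G$, so $G$ commutes with every $S_i$ and
   hence with $T_1$ and $T_2$. *)
- by split; apply: signed_pair_skew => // p u; rewrite ?T1E ?T2E !GE ?T1E ?T2E !simpS.
(* Each $GT_i$ is a multiple of $S_i$. *)
- apply: Z3_ind; rewrite ?GT1 ?GT2 ?GT3 //; exact: torsion_freeZ.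
Qed.

End FromHypersymplectic.

(** * From (para-)hyperkähler quadruples to (para-)hypersymplectic triplets *)

Section FromHyperkahler.
Variables (d : R) (T : 'Z_3 -> Endo E) (G : Endo E).
Hypotheses (d2 : d * d = 1) (secE : forall p (u : E p), exists X : Sec E, X p = u).
Hypotheses (hT : signed_hyperkahler d T G).
Hypotheses (sk1 : skew_symmetric_endo g (T 1)) (sk2 : skew_symmetric_endo g (T 2)).

Let S := S_of_TG (eps_of d) T G.

Let TT1 p (u : E p) : T 1 p (T 1 p u) = d *: u.
Proof.
have [_ [[TT _] _ _ _] _ _] := hT.
by rewrite -endo_compE TT endo_scaleE endo_idE.
Qed.

Let TT2 p (u : E p) : T 2 p (T 2 p u) = d *: u.
Proof.
have [_ [_ [TT _] _ _] _ _] := hT.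
by rewrite -endo_compE TT endo_scaleE endo_idE.
Qed.

Let T21 p (u : E p) : T 2 p (T 1 p u) = - T 1 p (T 2 p u).
Proof.
have [_ [_ _ aT _] _ _] := hT.
by rewrite -!endo_compE aT endo_oppE opprK.
Qed.

Let T3E p (u : E p) : T 3 p u = T 1 p (T 2 p u).
Proof. by have [_ [_ _ _ ->] _ _] := hT; rewrite endo_compE. Qed.

Let T1G p (u : E p) : T 1 p (G p u) = G p (T 1 p u).
Proof. by have [_ _ [h _] _] := hT; exact: (signed_pair_comm d2 secE sk1 h). Qed.

Let T2G p (u : E p) : T 2 p (G p u) = G p (T 2 p u).
Proof. by have [_ _ [_ h] _] := hT; exact: (signed_pair_comm d2 secE sk2 h). Qed.

Let GG p (u : E p) : G p (G p u) = u.
Proof.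
have [pG _ _ _] := hT.
by rewrite -endo_compE (pseudo_metric_involutive pG) endo_idE.
Qed.

Let S1E p (u : E p) : S 1 p u = - (d *: G p (T 1 p u)).
Proof.
by rewrite /S /S_of_TG !Z3E !eps_ofE endo_scaleE endo_compE mulrN1 scaleNr.
Qed.

Let S2E p (u : E p) : S 2 p u = G p (T 2 p u).
Proof.
by rewrite /S /S_of_TG !Z3E !eps_ofE endo_scaleE endo_compE d2 scale1r.
Qed.

Let S3E p (u : E p) : S 3 p u = - (d *: G p (T 1 p (T 2 p u))).
Proof.
by rewrite /S /S_of_TG !Z3E !eps_ofE endo_scaleE endo_compE mulN1r scaleNr T3E.
Qed.

(** Here the normal form has $G$ leftmost, then $T_1$, then $T_2$. *)
Let simpT := (endoN, endoZ, fun p => @scalerN R (E p),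
  fun p => @opprK (E p), T1G, T2G, GG, T21, TT1, TT2,
  fun p => @scalerA R (E p), d2, fun p => @scale1r R (E p)).

Let SE := (S1E, S2E, S3E).

Let sqrS i : S i \oE S i = eps_of d i *: Endo_id E.
Proof.
move: i; apply: Z3_ind; apply: endoP => p u;
by rewrite endo_compE !SE endo_scaleE endo_idE !eps_ofE !simpT ?mul1r ?scaleN1r.
Qed.

Lemma hypersymplectic_of_hyperkahler : eps_hypersymplectic g Theta (eps_of d) S.
Proof.
have [[sG _] _ _ tGT] := hT.
move: (sk1) (sk2) => /skew_endoP skT1 /skew_endoP skT2.
split=> //.
- apply: Z3_ind; apply/skew_endoP => p u v; rewrite !SE.
  + by rewrite metricNl metricNr metricZl metricZr sG skT1 mulrN T1G.
  + by rewrite sG skT2 T2G.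
  (* The transpose of $T_1T_2$ is $T_2T_1 = -T_1T_2$, so $T_3$ is skew as well. *)
  + rewrite metricNl metricNr metricZl metricZr sG skT1 skT2 opprK.
    by rewrite T1G T2G T21 endoN metricNr mulrN.
- have aS (i j : 'Z_3) : (forall p (u : E p), S i p (S j p u) = - S j p (S i p u)) ->
      S i \oE S j = eps_of d 1 * eps_of d 2 * eps_of d 3 *: (S j \oE S i).
    move=> h; apply: endoP => p u.
    by rewrite !eps_ofE d2 mul1r scaleN1r endo_oppE !endo_compE h.
  apply: Z3_ind; apply: Z3_ind => // _; apply: aS => p u;
  by rewrite !SE !simpT ?mul1r.
(* Condition (iii) becomes vanishing torsion of $S_i$, a multiple of $GT_i$. *)
- move=> i; apply/(deform2_eq_scale Theta (sqrS i)).
  exact: torsion_freeZ.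
Qed.

End FromHyperkahler.
End Structures.

(* In both (b) parts T_1 and T_2 are assumed skew-symmetric: this is the usual
   convention for (para-)complex structures on Courant algebroids, and without
   it (b) is false (take rho = 0, [.,.] = 0 and G a reflection).  Accordingly
   both (a) parts also produce skew-symmetric T_1 and T_2. *)
Theorem theorem6p8 (R : realType) (n : nat) (M : manifold R n) (r : nat)
    (E : vbundle M r) (g : metric E) (Theta : prestructure E)
    (HTheta : pre_courant g Theta) :
  (* hypersymplectic / hyperkahler *)
  ((* (a) *)
   (forall S : 'Z_3 -> Endo E, hypersymplectic g Theta S ->
      let T := T_of_S (eps_hyper R) S in
      let G := G_of_S S in
      [/\ hyperkahler g Theta T G,
          skew_symmetric_endo g (T 1) /\ skew_symmetric_endo g (T 2) &
          forall i, S i = S_of_TG (eps_hyper R) T G i]) /\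
   (* (b) *)
   (forall (T : 'Z_3 -> Endo E) (G : Endo E), hyperkahler g Theta T G ->
      skew_symmetric_endo g (T 1) -> skew_symmetric_endo g (T 2) ->
      hypersymplectic g Theta (S_of_TG (eps_hyper R) T G))) /\
  (* para-hypersymplectic / para-hyperkahler *)
  ((* (a) *)
   (forall S : 'Z_3 -> Endo E, para_hypersymplectic g Theta S ->
      let T := T_of_S (eps_para R) S in
      let G := G_of_S S in
      [/\ para_hyperkahler g Theta T G,
          skew_symmetric_endo g (T 1) /\ skew_symmetric_endo g (T 2) &
          forall i, S i = S_of_TG (eps_para R) T G i]) /\
   (* (b) *)
   (forall (T : 'Z_3 -> Endo E) (G : Endo E), para_hyperkahler g Theta T G ->
      skew_symmetric_endo g (T 1) -> skew_symmetric_endo g (T 2) ->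
      para_hypersymplectic g Theta (S_of_TG (eps_para R) T G))).
Proof.
have d2 : (-1) * (-1) = 1 :> R by rewrite mulrNN mulr1.
have secE := @section_through R n M r E.
rewrite /hypersymplectic /para_hypersymplectic.
(* [eps_para R] needs no such rewriting: it is [eps_of 1] by conversion. *)
have -> : eps_hyper R = eps_of (-1).
  by apply/funext => i; rewrite /eps_of if_same.
split; split=> [S|T G].
- case/(hyperkahler_of_hypersymplectic d2) => hT skT ST.
  by split=> //; exact/signed_hyperkahlerN1.
- by move/signed_hyperkahlerN1; exact: hypersymplectic_of_hyperkahler.
- case/(hyperkahler_of_hypersymplectic (mul1r 1)) => hT skT ST.
  by split=> //; exact/signed_hyperkahler1.
- by move/signed_hyperkahler1; exact: hypersymplectic_of_hyperkahler (mul1r 1) _.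
Qed.
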